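(* Let $\mathcal{F}$ be a hereditary family of finite graphs that is both weakly degree-bounded and has the density-EH property. Then there exists a constant $C=C(\mathcal{F})>0$ such that for every positive integer $s$, if $G\in\mathcal{F}$ is $K_{s,s}$-free, then the average degree of $G$ is at most $Cs$.
   Context: A family of graphs is hereditary if it is closed under taking induced subgraphs. A family $\mathcal{F}$ is weakly degree-bounded if there exists $k$ such that every $C_4$-free member of $\mathcal{F}$ has average degree at most $k$. A family $\mathcal{F}$ has the density-EH property if for every $c>0$ there exists $\delta=\delta(c)>0$ such that every $G\in\mathcal{F}$ with edge density at least $c$ contains a biclique of size at least $\delta v(G)$. Here $v(G)$ is the number of vertices of $G$, the edge density of $G$ is $e(G)/\binom{v(G)}{2}$, and a biclique of size $m$ is a complete bipartite graph with both vertex classes of size $m$. ''$C_4$-free'' and ''$K_{s,s}$-free'', as well as containing a biclique, refer to not necessarily induced subgraphs. *)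

(* Defs.v *)
From mathcomp Require Import all_boot all_order all_algebra.
From mathcomp Require Import reals.

Set Implicit Arguments.
Unset Strict Implicit.
Unset Printing Implicit Defensive.

Import Order.TTheory GRing.Theory Num.Theory.

Local Open Scope ring_scope.

Record sgraph : Type := SGraph {
  vertex :> finType;
  adj : rel vertex;
  adj_sym : symmetric adj;
  adj_irrefl : irreflexive adj
}.

Section Induced.
Variables (G : sgraph) (S : {set G}).

Definition induced_adj : rel {x : G | x \in S} :=
  fun x y => adj (val x) (val y).

Lemma induced_adj_sym : symmetric induced_adj.
Proof. by move=> x y; exact: adj_sym. Qed.

Lemma induced_adj_irrefl : irreflexive induced_adj.
Proof. by move=> x; exact: adj_irrefl. Qed.

Definition induced : sgraph := SGraph induced_adj_sym induced_adj_irrefl.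
End Induced.

Section CompleteBipartite.
Variables s t : nat.

Definition Kst_adj : rel ('I_s + 'I_t) :=
  fun x y => match x, y with
             | inl _, inr _ | inr _, inl _ => true
             | _, _ => false
             end.

Lemma Kst_adj_sym : symmetric Kst_adj.
Proof. by move=> [?|?] [?|?]. Qed.

Lemma Kst_adj_irrefl : irreflexive Kst_adj.
Proof. by move=> [?|?]. Qed.

Definition complete_bipartite : sgraph := SGraph Kst_adj_sym Kst_adj_irrefl.
End CompleteBipartite.

Definition C4_adj : rel 'I_4 :=
  fun x y => (x.+1 %% 4 == y)%N || (y.+1 %% 4 == x)%N.

Lemma C4_adj_sym : symmetric C4_adj.
Proof. by move=> x y; rewrite /C4_adj orbC. Qed.

Lemma C4_adj_irrefl : irreflexive C4_adj.
Proof. by move=> [[|[|[|[|n]]]] Hn]. Qed.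

Definition C4 : sgraph := SGraph C4_adj_sym C4_adj_irrefl.

(* Not necessarily induced subgraphs: only the edges of H must be preserved. *)
Definition contains (G H : sgraph) : Prop :=
  exists2 f : H -> G, injective f & forall x y : H, adj x y -> adj (f x) (f y).

Definition subgraph_free (H G : sgraph) : Prop := ~ contains G H.

Definition has_biclique (G : sgraph) (m : nat) : Prop :=
  contains G (complete_bipartite m m).

Definition edges (G : sgraph) :=
  [set [set p.1; p.2] | p : G * G & adj p.1 p.2].

Definition degree (G : sgraph) (x : G) : nat := #|[set y | adj x y]|.

(* Since x / 0 = 0, the empty graph has average degree 0, and graphs with at
   most one vertex have edge density 0. *)
Definition average_degree (R : realType) (G : sgraph) : R :=
  (\sum_(x : G) degree x)%N%:R / #|G|%:R.

Definition edge_density (R : realType) (G : sgraph) : R :=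
  #|edges G|%:R / 'C(#|G|, 2)%:R.

(* Families are arbitrary predicates; closure under isomorphism is not
   assumed. *)
Definition hereditary (F : sgraph -> Prop) : Prop :=
  forall (G : sgraph) (S : {set G}), F G -> F (induced S).

Definition weakly_degree_bounded (R : realType) (F : sgraph -> Prop) : Prop :=
  exists k : R, forall G : sgraph, F G -> subgraph_free C4 G -> average_degree R G <= k.

Definition density_EH (R : realType) (F : sgraph -> Prop) : Prop :=
  forall c : R, 0 < c ->
  exists2 delta : R, 0 < delta &
  forall G : sgraph, F G -> c <= edge_density R G ->
  exists2 m : nat, delta * #|G|%:R <= m%:R & has_biclique G m.

(* Main.v *)
Require Import Defs.
From mathcomp Require Import all_boot all_order all_algebra.
From mathcomp Require Import reals.
From mathcomp Require Import zify.

(** The proof finds, in a K_{s,s}-free member G of the family of average degree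
at least C s, an induced subgraph that one of the two hypotheses on the family
forbids: a C4-free one of large average degree, or a dense one without a
biclique of linear size.

Pass to the scale D >= C s of the densest vertex set, so that every vertex set
U carries at most D |U| ordered adjacent pairs ([densest_scale]).  If C is
large, density-EH makes G locally sparse at scale D: for a set Z of at least
D/P vertices, at most D/P vertices are adjacent to a P-th of Z
([locally_sparse_of_biclique_free]), because otherwise Z and those vertices
would contain a dense graph on about 2 D/P vertices, hence a biclique of size s.

Suppose first that a positive proportion of the arcs lies among vertices of
degree O(D).  Local sparsity then leaves o(D^3) four-cycles per vertex, so a
random induced subgraph of constant average degree has few of them; deleting
one vertex from each gives an induced C4-free subgraph whose average degree is
too large ([bounded_degree_few_arcs]).  So most arcs join a set Y of vertices
of degree O(D) to a much smaller set X ([unbalanced_pair]).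

Fix such a pair.  Call two vertices of X heavy if they are equal, adjacent, or
have more than L D common neighbours in Y.  If many y in Y had many k-tuples of
pairwise non-heavy neighbours, then sampling X with probability about 1/D would
leave, for many y, exactly such a tuple as sampled neighbourhood.  Two such y
conflict if they are adjacent or share two sampled neighbours, and this happens
for only O(D) partners of y, so an independent set of them spans with the
sample an induced C4-free subgraph of average degree above k
([few_light_maps]).  Hence heavy pairs are abundant: most y see many pairs of
non-adjacent neighbours b, b' with a large common neighbourhood.  Repeating the
argument inside the neighbourhood of a single b, r times, produces a positive
proportion of r-tuples of pairwise non-adjacent neighbours of y with at least D
common neighbours ([rich_stars_ge]).

For a typical such tuple, no b_i is adjacent to a P-th of the common
neighbourhood of other entries, by local sparsity ([unrelated_star]).
Therefore every subset of the tuple is the exact trace of at least D/2 vertices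
of Y: the tuple is shattered ([exact_trace]).  Any bipartite graph with r
vertices on that side is then an induced subgraph of G, the other side being
made independent by local sparsity ([independent_transversal]).  Choosing for
it the graph in which two subsets of a t-element set are adjacent when their
intersection has odd size gives density at least 1/8 and no biclique larger
than the square root of r, by orthogonality of characters
([odd_meet_rectangle]).  For r large this contradicts density-EH.

All estimates are stated with natural numbers, for vertex sets of G rather
than for induced subgraphs. *)

Set Implicit Arguments.
Unset Strict Implicit.
Unset Printing Implicit Defensive.

Import Order.TTheory GRing.Theory Num.Theory.

(** * Ordered adjacent pairs *)

Section Arcs.
Variable G : sgraph.
Implicit Types (A B U W : {set G}) (x y : G).

Definition nbrs x : {set G} := [set y | adj x y].

Definition arcs A B := \sum_(x in A) #|nbrs x :&: B|.

Lemma in_nbrs x y : (y \in nbrs x) = adj x y. Proof. by rewrite inE. Qed.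

Lemma nbrsC x y : (y \in nbrs x) = (x \in nbrs y).
Proof. by rewrite !inE adj_sym. Qed.

Lemma arcsE A B : arcs A B = \sum_(x in A) \sum_(y in B) adj x y.
Proof.
apply: eq_bigr => x _; rewrite -sum1_card [RHS]big_mkcond [LHS]big_mkcond /=.
by apply: eq_bigr => y _; rewrite !inE; do 2 case: ifP => //=; case: adj.
Qed.

Lemma arcsC A B : arcs A B = arcs B A.
Proof.
rewrite !arcsE exchange_big; apply: eq_bigr => x _; apply: eq_bigr => y _.
by rewrite adj_sym.
Qed.

Lemma arcsS A A' B B' : A \subset A' -> B \subset B' -> arcs A B <= arcs A' B'.
Proof.
move=> sA sB; rewrite /arcs [leqRHS](big_setID A) /= (setIidPr sA).
by apply: leq_trans (leq_addr _ _); apply: leq_sum => x _; rewrite subset_leq_card ?setIS.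
Qed.

Lemma arcsDl A A' B : A \subset A' -> arcs A' B = arcs A B + arcs (A' :\: A) B.
Proof. by move=> sA; rewrite /arcs (big_setID A) /= (setIidPr sA). Qed.

Lemma arcsDr A B B' : B \subset B' -> arcs A B' = arcs A B + arcs A (B' :\: B).
Proof. by move=> sB; rewrite arcsC (arcsDl _ sB) !(arcsC A). Qed.

Lemma arcs_le A B m : (forall x, x \in A -> #|nbrs x :&: B| <= m) -> arcs A B <= m * #|A|.
Proof. by move=> h; rewrite mulnC -sum_nat_const; apply: leq_sum. Qed.

Lemma arcs_ge A B m : (forall x, x \in A -> m <= #|nbrs x :&: B|) -> m * #|A| <= arcs A B.
Proof. by move=> h; rewrite mulnC -sum_nat_const; apply: leq_sum. Qed.
End Arcs.

(** * Random colourings *)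

Section Colouring.
Variables (V : finType) (N : nat).
Implicit Types (U Z : {set V}) (w : {ffun V -> 'I_N.+1}).

Definition zero_on U := [set w : {ffun V -> 'I_N.+1} | [forall x in U, w x == ord0]].

Lemma card_zero_on U : #|zero_on U| * N.+1 ^ #|U| = N.+1 ^ #|V|.
Proof.
have -> : #|zero_on U| = \prod_(x : V) (if x \in U then 1 else N.+1).
  have -> : #|zero_on U| =
     #|family (fun x => if x \in U then pred1 (ord0 : 'I_N.+1) else predT)|.
    apply: eq_card => w; rewrite inE; apply/forall_inP/familyP => h x.
      by case: ifP => // /h.
    by move=> xU; have := h x; rewrite xU.
  rewrite card_family foldrE big_map big_enum /=; apply: eq_bigr => x _.
  by case: ifP => _; [exact: card1 | rewrite card_ord].
rewrite -(prod_nat_const (mem U)) -(prod_nat_const (@predT V)) [X in _ * X]big_mkcond -big_split /=.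
by apply: eq_bigr => x _; case: ifP; rewrite ?mul1n ?muln1.
Qed.

Lemma card_zero_onU1 x U : x \notin U -> #|zero_on (x |: U)| * N.+1 = #|zero_on U|.
Proof.
move=> xU; apply/eqP; rewrite -(@eqn_pmul2r (N.+1 ^ #|U|)) ?expn_gt0 //.
by rewrite -mulnA -expnS card_zero_on -(card_zero_on (x |: U)) cardsU1 xU.
Qed.

(** Sampling keeps each vertex with probability 1/(N+1), as the colour class of
a uniform colouring.  A union bound over Z shows that, conditionally on U being
sampled, Z is missed with probability at least 1/2. *)
Lemma card_zero_on_avoid U Z : 2 * #|Z| <= N.+1 -> [disjoint U & Z] ->
  #|zero_on U| <= 2 * #|[set w in zero_on U | [forall z in Z, w z != ord0]]|.
Proof.
move=> hZ dUZ; set E := [set w in _ | _].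
have : #|zero_on U| <= #|E| + \sum_(z in Z) #|zero_on (z |: U)|.
  have sub : zero_on U \subset E :|: \bigcup_(z in Z) zero_on (z |: U).
    apply/subsetP => w wU; rewrite inE.
    case: (boolP (w \in E)) => //= wE; apply/bigcupP.
    move: wE; rewrite inE wU /= negb_forall_in => /exists_inP[z zZ]; rewrite negbK => wz.
    exists z => //; rewrite inE; apply/forall_inP => x /setU1P[->//|xU].
    by move: wU; rewrite inE => /forall_inP/(_ x xU).
  apply: leq_trans (subset_leq_card sub) _; apply: leq_trans (leq_card_setU _ _) _.
  rewrite leq_add2l; elim/big_rec2: _ => [|z n S _ le]; first by rewrite cards0.
  by apply: leq_trans (leq_card_setU _ _) _; rewrite leq_add2l.
have : \sum_(z in Z) #|zero_on (z |: U)| * N.+1 = #|Z| * #|zero_on U|.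
  rewrite -sum_nat_const; apply: eq_bigr => z zZ; apply: card_zero_onU1.
  by rewrite disjoint_sym in dUZ; rewrite (disjointFr dUZ).
rewrite -big_distrl /= => eqS leS; nia.
Qed.
End Colouring.

(** * Degenerate relations *)

Lemma leq_expl e m n : m <= n -> m ^ e <= n ^ e.
Proof. by case: e => // e; rewrite leq_exp2r. Qed.

(** Greedy choice: a vertex of small degree is taken and its neighbours are
discarded. *)
Lemma independent_subset (T : finType) (c : rel T) (E : nat) (A : {set T}) :
  symmetric c ->
  (forall U : {set T}, U \subset A -> U != set0 ->
     exists2 u, u \in U & #|[set v in U | c u v]| <= E) ->
  exists I : {set T}, [/\ I \subset A,
    {in I &, forall x y, x != y -> ~~ c x y} & #|A| <= E.+1 * #|I|].
Proof.
move=> c_sym; have [n] := ubnP #|A|; elim: n A => // n IHn A ltAn lowA.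
have [->|A_neq0] := eqVneq A set0.
  by exists set0; split; rewrite ?sub0set ?cards0 // => x y; rewrite inE.
have [u uA leE] := lowA A (subxx _) A_neq0.
pose C := u |: [set v in A | c u v].
have sCA : C \subset A by apply/subsetP => v /setU1P[->//|]; rewrite inE => /andP[].
have leC : #|C| <= E.+1.
  by rewrite cardsU1 -add1n; apply: leq_add => //; case: (_ \notin _).
have ltC : #|A :\: C| < n.
  have := cardsID C A; rewrite (setIidPr sCA) => cA.
  have : 0 < #|C| by apply/card_gt0P; exists u; rewrite setU11.
  lia.
have [||I [sI indI leI]] := IHn (A :\: C).
- by [].
- move=> U sU; apply: lowA; exact: subset_trans sU (subsetDl _ _).
have uI : u \notin I by apply: contraL uA => /(subsetP sI); rewrite !inE eqxx.
have cu v : v \in I -> ~~ c u v.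
  by move/(subsetP sI); rewrite !inE negb_or negb_and => /andP[/andP[_]]; case: (v \in A).
exists (u |: I); split.
- by apply/subUsetP; split; [rewrite sub1set | exact: subset_trans sI (subsetDl _ _)].
- move=> x y /setU1P[->|xI] /setU1P[->|yI] neq; first by rewrite eqxx in neq.
  + exact: cu.
  + by rewrite c_sym cu.
  + exact: indI.
rewrite cardsU1 uI mulnDr muln1; have := cardsID C A; rewrite (setIidPr sCA); lia.
Qed.

Section Degenerate.
Variables (G : sgraph) (D : nat).
Hypothesis arcsD : forall U : {set G}, arcs U U <= D * #|U|.

Lemma low_degree_vertex (U : {set G}) : U != set0 -> exists2 u, u \in U & #|nbrs u :&: U| <= D.
Proof.
move=> U_neq0; apply/exists_inP; apply: contraTT isT; rewrite negb_exists_in => /forall_inP h.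
have : D.+1 * #|U| <= arcs U U by apply: arcs_ge => x /h; rewrite -ltnNge.
have := arcsD U; have : 0 < #|U| by rewrite card_gt0.
nia.
Qed.

(** The out-neighbourhoods of a degenerate orientation.  They turn independence
of a sample into at most D exclusions per vertex: a vertex is kept when none
of its out-neighbours is sampled, whatever its degree is. *)
Lemma orientation : exists out : G -> {set G},
  (forall v, out v \subset nbrs v /\ #|out v| <= D) /\
  forall u v : G, adj u v -> (u \in out v) || (v \in out u).
Proof.
suff h (U : {set G}) : exists out : G -> {set G},
    (forall v, out v \subset nbrs v /\ #|out v| <= D) /\
    {in U &, forall u v, adj u v -> (u \in out v) || (v \in out u)}.
  by have [out [? outP]] := h setT; exists out; split=> // u v; apply: outP; rewrite inE.
have [n] := ubnP #|U|; elim: n U => // n IHn U ltUn.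
have [->|/low_degree_vertex[u uU leD]] := eqVneq U set0.
  by exists (fun=> set0); split=> [v|u v]; rewrite ?sub0set ?cards0 // inE.
have [|out [out_le outP]] := IHn (U :\ u); first by have := cardsD1 u U; rewrite uU; lia.
exists (fun v => if v == u then nbrs u :&: U else out v); split=> [v|x y xU yU xy].
  by case: ifP => [/eqP->|_] //; rewrite subsetIl.
have [xu|xu] := eqVneq x u; have [yu|yu] := eqVneq y u.
- by move: xy; rewrite xu yu adj_irrefl.
- by rewrite orbC inE in_nbrs -xu xy yU.
- by rewrite inE in_nbrs adj_sym -yu xy xU.
by apply: outP; rewrite // !inE ?xu ?yu.
Qed.
End Degenerate.

(** * Tuples whose entries pairwise avoid a relation *)

Section Cons.
Variable T : finType.

Definition fcons n (x : T) (g : {ffun 'I_n -> T}) : {ffun 'I_n.+1 -> T} :=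
  [ffun i => if unlift ord0 i is Some j then g j else x].

Lemma fcons0 n x (g : {ffun 'I_n -> T}) : fcons x g ord0 = x.
Proof. by rewrite ffunE unlift_none. Qed.

Lemma fconsS n x (g : {ffun 'I_n -> T}) i : fcons x g (lift ord0 i) = g i.
Proof. by rewrite ffunE liftK. Qed.

Lemma sum_fcons n (F : {ffun 'I_n.+1 -> T} -> nat) :
  \sum_f F f = \sum_x \sum_g F (fcons x g).
Proof.
rewrite pair_bigA /= (reindex (fun p : T * {ffun 'I_n -> T} => fcons p.1 p.2)) //=.
exists (fun f => (f ord0, [ffun i => f (lift ord0 i)])) => [[x g] _|f _] /=.
  by rewrite fcons0; congr (_, _); apply/ffunP => i; rewrite ffunE fconsS.
by apply/ffunP => i; case: (unliftP ord0 i) => [j ->|->]; [rewrite fconsS ffunE | rewrite fcons0].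
Qed.

Lemma forall_fcons n x (g : {ffun 'I_n -> T}) (P : pred T) :
  [forall i, P (fcons x g i)] = P x && [forall i, P (g i)].
Proof.
apply/forallP/andP => [h|[px /forallP pg] i].
  by split; [have := h ord0; rewrite fcons0 | apply/forallP => i; have := h (lift ord0 i); rewrite fconsS].
by case: (unliftP ord0 i) => [j ->|->]; rewrite ?fconsS ?fcons0.
Qed.

Definition spread (h : rel T) n (f : {ffun 'I_n -> T}) :=
  [forall i, forall j, (i != j) ==> ~~ h (f i) (f j)].

Lemma spreadP (h : rel T) n (f : {ffun 'I_n -> T}) :
  reflect (forall i j, i != j -> ~~ h (f i) (f j)) (spread h f).
Proof.
apply: (iffP forallP) => [H i j ij|H i]; first by have /forallP/(_ j)/implyP := H i; apply.
by apply/forallP => j; apply/implyP; apply: H.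
Qed.

Lemma spread_fcons (h : rel T) n x (g : {ffun 'I_n -> T}) : symmetric h ->
  spread h (fcons x g) = [forall i, ~~ h x (g i)] && spread h g.
Proof.
move=> h_sym; apply/spreadP/andP => [H|[/forallP hx /spreadP hg] i j].
  split; first by apply/forallP => i; have := H ord0 (lift ord0 i); rewrite fcons0 fconsS; apply.
  apply/spreadP => i j ij; have := H (lift ord0 i) (lift ord0 j).
  by rewrite !fconsS; apply; rewrite (inj_eq (@lift_inj _ _)).
case: (unliftP ord0 i) => [i' ->|->]; case: (unliftP ord0 j) => [j' ->|->];
  rewrite ?fconsS ?fcons0 ?(inj_eq (@lift_inj _ _)) ?eqxx //; first exact: hg.
by rewrite h_sym.
Qed.

Definition spread_maps h n (M : {set T}) := [set f : {ffun 'I_n -> T} | [forall i, f i \in M] && spread h f].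

Lemma card_spread_mapsS h n (M : {set T}) : symmetric h ->
  #|spread_maps h n.+1 M| = \sum_(x in M) #|spread_maps h n [set y in M | ~~ h x y]|.
Proof.
move=> h_sym; rewrite -sum1_card big_mkcond sum_fcons [RHS]big_mkcond /=.
apply: eq_bigr => x _; case: ifP => xM; last first.
  rewrite big1 // => g _; case: ifP => //.
  by rewrite !inE (forall_fcons _ _ (mem M)) /= xM.
rewrite -sum1_card [RHS]big_mkcond; apply: eq_bigr => g _; congr (if _ then _ else _).
rewrite !inE (forall_fcons _ _ (mem M)) /= xM spread_fcons //= andbA; congr (_ && _).
apply/andP/forallP => [[/forallP h1 /forallP h2] i|H]; first by rewrite inE h1 h2.
by split; apply/forallP => i; have := H i; rewrite inE => /andP[].
Qed.

(** Entries are chosen one after the other; each choice rules out at most E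
elements of M. *)
Lemma card_spread_maps_ge (h : rel T) n E (M : {set T}) : symmetric h ->
  (forall x, x \in M -> #|[set y in M | h x y]| <= E) ->
  (#|M| - n * E) ^ n <= #|spread_maps h n M|.
Proof.
move=> h_sym; elim: n M => [|n IHn] M lowM.
  have /card_gt0P[f _] : 0 < #|{: {ffun 'I_0 -> T}}| by rewrite card_ffun card_ord.
  rewrite expn0 card_gt0; apply/set0Pn.
  by exists f; rewrite inE; apply/andP; split; apply/forallP => -[].
rewrite (card_spread_mapsS _ _ h_sym).
apply: leq_trans (_ : \sum_(x in M) (#|M| - n.+1 * E) ^ n <= _).
  by rewrite sum_nat_const expnS leq_mul2r leq_subr orbT.
apply: leq_sum => x xM; apply: leq_trans (IHn _ _).
  have := lowM x xM; have <- : M :\: [set y in M | ~~ h x y] = [set y in M | h x y].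
    by apply/setP => y; rewrite !inE; case: (y \in M); rewrite ?andbF //= negbK andbT.
  rewrite cardsDS; last by apply/subsetP => y; rewrite inE => /andP[].
  by move=> le_E; apply: leq_expl; lia.
move=> y; rewrite inE => /andP[yM _]; apply: leq_trans (lowM y yM).
by apply: subset_leq_card; apply/subsetP => z; rewrite !inE => /andP[/andP[-> _] ->].
Qed.
End Cons.

(** * Samples of an unbalanced pair *)
Lemma card_bigcup_le (I T : finType) (P : pred I) (F : I -> {set T}) :
  #|\bigcup_(i | P i) F i| <= \sum_(i | P i) #|F i|.
Proof.
elim/big_rec2: _ => [|i n S _ le]; first by rewrite cards0.
by apply: leq_trans (leq_card_setU _ _) _; rewrite leq_add2l.
Qed.

Definition c4free (G : sgraph) (W : {set G}) : Prop :=
  forall x0 x1 x2 x3 : G, x0 \in W -> x1 \in W -> x2 \in W -> x3 \in W ->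
    adj x0 x1 -> adj x1 x2 -> adj x2 x3 -> adj x3 x0 -> x0 != x2 -> x1 != x3 -> False.

Definition c4free_bounded (G : sgraph) k :=
  forall W : {set G}, c4free W -> arcs W W <= k * #|W|.

Lemma bipartite_c4free (G : sgraph) (A B : {set G}) :
  {in A &, forall x y, ~~ adj x y} -> {in B &, forall x y, ~~ adj x y} ->
  {in A &, forall x y, x != y -> #|nbrs x :&: nbrs y :&: B| <= 1} ->
  c4free (A :|: B).
Proof.
move=> indA indB cod.
have key x0 x1 x2 x3 : x0 \in A -> x1 \in A :|: B -> x2 \in A :|: B -> x3 \in A :|: B ->
    adj x0 x1 -> adj x1 x2 -> adj x2 x3 -> adj x3 x0 -> x0 != x2 -> x1 != x3 -> False.
  move=> x0A x1W x2W x3W a01 a12 a23 a30 n02 n13.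
  have AB x y : x \in A -> y \in A :|: B -> adj x y -> y \in B.
    by move=> xA /setUP[yA|//] axy; have := indA _ _ xA yA; rewrite axy.
  have BA x y : x \in B -> y \in A :|: B -> adj x y -> y \in A.
    by move=> xB /setUP[//|yB] axy; have := indB _ _ xB yB; rewrite axy.
  have x1B := AB _ _ x0A x1W a01.
  have x2A := BA _ _ x1B x2W a12.
  have x3B := AB _ _ x2A x3W a23.
  have := cod _ _ x0A x2A n02; rewrite leqNgt => /negP; apply.
  apply/card_gt1P; exists x1, x3; split=> //; rewrite !inE ?a01 ?x1B ?x3B ?andbT.
    by rewrite adj_sym.
  by rewrite adj_sym a30.
move=> x0 x1 x2 x3 x0W x1W x2W x3W a01 a12 a23 a30 n02 n13.
case/setUP: (x0W) => [x0A|x0B]; first exact: (key x0 x1 x2 x3).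
case/setUP: (x1W) => [x1A|x1B]; last by have := indB _ _ x0B x1B; rewrite a01.
by apply: (key x1 x2 x3 x0) => //; rewrite eq_sym.
Qed.

Section FewSpreadMaps.
Variables (G : sgraph) (D k L a : nat) (Y X : {set G}).
Hypothesis D_gt0 : 0 < D.
Hypothesis arcsD : forall U : {set G}, arcs U U <= D * #|U|.
Hypothesis c4k : c4free_bounded G k.
Hypothesis disYX : [disjoint Y & X].
Hypothesis degY : forall y, y \in Y -> #|nbrs y :&: X| <= a * D.

Definition heavy (Y' : {set G}) m : rel G :=
  fun b b' => [|| b == b', adj b b' | m < #|nbrs b :&: nbrs b' :&: Y'|].

Lemma heavy_sym Y' m : symmetric (heavy Y' m).
Proof. by move=> x y; rewrite /heavy eq_sym adj_sym (setIC (nbrs x)). Qed.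

Let q := k.+1.
Let light y := spread_maps (heavy Y (L * D)) q (nbrs y :&: X).

Variable out : G -> {set G}.
Hypothesis out_nbrs : forall v, out v \subset nbrs v.
Hypothesis out_le : forall v, #|out v| <= D.
Hypothesis outP : forall u v : G, adj u v -> (u \in out v) || (v \in out u).

Section Sample.
Variable S : {set G}.
Hypothesis sSX : S \subset X.

(** The sampled neighbourhood of a caught vertex can be kept as it is: it is
independent, any two of its members have few common neighbours in Y, and making
the whole sample independent removes none of them. *)
Definition hits y (f : {ffun 'I_q -> G}) :=
  [&& f \in light y, nbrs y :&: S == [set f i | i in 'I_q] &
      [forall i, [disjoint out (f i) & S]]].

Lemma light_adj y f i : f \in light y -> f i \in nbrs y :&: X.
Proof. by rewrite inE => /andP[/forallP/(_ i)]. Qed.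

Lemma light_heavy y f i j : f \in light y -> i != j -> ~~ heavy Y (L * D) (f i) (f j).
Proof. by rewrite inE => /andP[_ /spreadP]; apply. Qed.

Lemma light_inj y f : f \in light y -> injective f.
Proof.
move=> fl i j eq_f; apply/eqP; apply: contraT => ij.
by have := light_heavy fl ij; rewrite /heavy eq_f eqxx.
Qed.

Definition caught := [set y in Y | [exists f, hits y f]].

(** Otherwise the caught vertices contain an independent set I larger than S no
two members of which have two common neighbours in S.  The members of S without
out-neighbour in S are independent and contain the k+1 sampled neighbours of
every y in I, so together with I they induce a C4-free graph of average degree
at least k+1. *)
Lemma card_caught : #|caught| <= (D + q * q * (L * D)).+1 * #|S|.
Proof.
pose c : rel G := fun y y' => adj y y' || (1 < #|nbrs y :&: nbrs y' :&: S|).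
have c_sym : symmetric c by move=> y y'; rewrite /c adj_sym (setIC (nbrs y)).
have [U sU U_neq0|I [sI indI leI]] := @independent_subset _ c (D + q * q * (L * D)) caught c_sym.
  have [u uU leD] := low_degree_vertex arcsD U_neq0; exists u => //.
  have := subsetP sU u uU; rewrite inE => /andP[uY /existsP[f /and3P[fl /eqP fS _]]].
  have sub : [set v in U | c u v] \subset (nbrs u :&: U) :|:
      \bigcup_(p : 'I_q * 'I_q | p.1 != p.2) (nbrs (f p.1) :&: nbrs (f p.2) :&: Y).
    apply/subsetP => v; rewrite inE => /andP[vU /orP[auv|/card_gt1P[b [b' [bP b'P bb']]]]].
      by rewrite inE inE in_nbrs auv vU.
    have fib x : x \in nbrs u :&: nbrs v :&: S -> exists2 i, x = f i & v \in nbrs x.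
      move=> /setIP[/setIP[xu xv] xS]; have : x \in nbrs u :&: S by rewrite inE xu.
      by rewrite fS => /imsetP[i _ xi]; exists i; rewrite // nbrsC.
    have [i bi vb] := fib _ bP; have [j b'j vb'] := fib _ b'P.
    rewrite inE; apply/orP; right; apply/bigcupP; exists (i, j) => /=.
      by apply: contraNneq bb' => ij; rewrite bi b'j ij.
    by rewrite -bi -b'j !inE -!in_nbrs vb vb' /=; have := subsetP sU v vU; rewrite inE => /andP[].
  apply: leq_trans (subset_leq_card sub) _; apply: leq_trans (leq_card_setU _ _) _.
  rewrite leq_add //; apply: leq_trans (card_bigcup_le _ _) _.
  apply: leq_trans (_ : \sum_(p : 'I_q * 'I_q) L * D <= _).
    rewrite big_mkcond; apply: leq_sum => p _; case: ifP => // pp.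
    by have := light_heavy fl pp; rewrite /heavy !negb_or -leqNgt => /and3P[].
  by rewrite sum_nat_const card_prod card_ord.
(* Keeping only these makes the sample independent. *)
pose B := [set b in S | [disjoint out b & S]].
have sBS : B \subset S by apply/subsetP => b; rewrite inE => /andP[].
have sIY : I \subset Y by apply: subset_trans sI _; apply/subsetP => y; rewrite inE => /andP[].
have NB y : y \in I -> nbrs y :&: B = nbrs y :&: S /\ #|nbrs y :&: S| = q.
  move/(subsetP sI); rewrite inE => /andP[_ /existsP[f /and3P[fl /eqP fS /forallP fo]]].
  split; last by rewrite fS card_imset ?card_ord //; exact: light_inj fl.
  apply/eqP; rewrite eqEsubset setIS //=; apply/subsetP => b bS.
  have := bS; rewrite fS => /imsetP[i _ bi]; move: bS; rewrite !inE => /andP[-> ->] /=.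
  by rewrite bi fo.
have dIB : [disjoint I & B].
  rewrite disjoint_subset; apply/subsetP => y /(subsetP sIY) yY; rewrite !inE.
  by rewrite negb_and; apply/orP; left; apply: contraL yY => /(subsetP sSX) yX; rewrite (disjointFl disYX yX).
have free : c4free (I :|: B).
  apply: bipartite_c4free => [x y xI yI|x y|x y xI yI xy].
  - have [->|xy] := eqVneq x y; first by rewrite adj_irrefl.
    by have := indI _ _ xI yI xy; rewrite negb_or => /andP[].
  - rewrite !inE => /andP[xS ox] /andP[yS oy]; apply/negP => /outP/orP[xo|yo].
      by rewrite (disjointFr oy xo) in xS.
    by rewrite (disjointFr ox yo) in yS.
  have := indI _ _ xI yI xy; rewrite negb_or -leqNgt => /andP[_]; apply: leq_trans.
  by rewrite subset_leq_card // setIS.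
have leIB : q * #|I| <= arcs I B by apply: arcs_ge => y /NB[-> ->].
have leW : 2 * (q * #|I|) <= arcs (I :|: B) (I :|: B).
  rewrite mul2n -addnn (arcsDl _ (subsetUl I B)) leq_add //.
    by apply: leq_trans leIB _; rewrite arcsS // subsetUr.
  rewrite arcsC in leIB; apply: leq_trans leIB _; apply: arcsS; last exact: subsetUl.
  by rewrite setDUl setDv set0U; apply/subsetDP; rewrite disjoint_sym.
have leC := c4k free; have [leU _] := leq_card_setU I B; have leBS := subset_leq_card sBS.
suff : #|I| <= #|S| by move=> le; apply: leq_trans leI _; rewrite leq_mul2l le orbT.
rewrite leqNgt; apply/negP => lt_SI; move: leW; rewrite leqNgt => /negP; apply.
have leU' : #|I :|: B| <= #|I| + #|I| by lia.
apply: leq_ltn_trans leC _; apply: leq_ltn_trans (leq_mul (leqnn k) leU') _.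
rewrite /q mulSn; lia.
Qed.
End Sample.

(** Average of [card_caught] over a random S: a tuple of light vertices in the
neighbourhood of y catches y with probability at least (N+1)^-(k+1) / 2, since it
has to avoid only O(D) further vertices. *)
Lemma sum_light : \sum_(y in Y) #|light y| <=
  (2 * q ^ q * (2 + q * q * L) * (2 * (a + q)) ^ k) * D ^ q * #|X|.
Proof.
(* N.+1 is twice a bound for the number of vertices that a catching sample avoids. *)
pose N := (2 * (a + q) * D).-1.
have NE : N.+1 = 2 * (a + q) * D by rewrite prednK // !muln_gt0 D_gt0 /= addnS.
pose S (w : {ffun G -> 'I_N.+1}) := [set x in X | w x == ord0].
have sSX w : S w \subset X by apply/subsetP => x; rewrite inE => /andP[].
pose T := N.+1 ^ #|G|.
have sumS : (\sum_w #|S w|) * N.+1 = #|X| * T.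
  have -> : \sum_w #|S w| = \sum_(x in X) #|zero_on N [set x]|.
    under eq_bigr => w _ do rewrite -sum1_card big_mkcond /=.
    rewrite exchange_big [RHS]big_mkcond; apply: eq_bigr => x _.
    case: ifP => xX; last by rewrite big1 // => w _; rewrite inE xX.
    rewrite -sum1_card [RHS]big_mkcond; apply: eq_bigr => w _; congr (if _ then _ else _).
    rewrite !inE xX /=; apply/idP/forall_inP => [wx z /set1P->//|]; apply; exact: set11.
  rewrite big_distrl -sum_nat_const; apply: eq_bigr => x _ /=.
  by have := card_zero_on N [set x]; rewrite cards1 expn1.
have hit_prob y f : y \in Y -> f \in light y ->
    T <= 2 * N.+1 ^ q * #|[set w | hits (S w) y f]|.
  move=> yY fl; pose U := [set f i | i in 'I_q].
  have cU : #|U| = q by rewrite card_imset ?card_ord //; exact: light_inj fl.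
  pose Z := (nbrs y :&: X :|: \bigcup_i out (f i)) :\: U.
  have leZ : 2 * #|Z| <= N.+1.
    rewrite NE -mulnA leq_mul2l /= mulnDl; apply: leq_trans (subset_leq_card (subsetDl _ _)) _.
    apply: leq_trans (leq_card_setU _ _) _; rewrite leq_add ?degY //.
    apply: leq_trans (card_bigcup_le _ _) _; apply: leq_trans (_ : \sum_(i < q) D <= _).
      by apply: leq_sum => i _; exact: out_le.
    by rewrite sum_nat_const card_ord.
  have dUZ : [disjoint U & Z] by rewrite disjoint_sym disjoints_subset /Z setDE subsetIr.
  rewrite /T -(card_zero_on N U) cU [leqRHS]mulnAC leq_mul2r; apply/orP; right.
  apply: leq_trans (card_zero_on_avoid leZ dUZ) _; rewrite leq_mul2l /=.
  apply: subset_leq_card; apply/subsetP => w; rewrite !inE => /andP[/forall_inP wU /forall_inP wZ].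
  apply/and3P; split=> //.
    apply/eqP/setP => x; rewrite [LHS]inE [x \in S w]inE; apply/andP/idP => [[xy /andP[xX wx]]|xU].
      by apply: contraLR wx => xU; apply: wZ; rewrite inE xU inE inE xy xX.
    have := wU x xU; case/imsetP: xU => i _ ->; have := light_adj i fl.
    by rewrite inE => /andP[-> ->] ->.
  apply/forallP => i; rewrite disjoint_subset; apply/subsetP => x xo; rewrite !inE negb_and.
  apply/orP; right; apply: wZ; rewrite inE inE; apply/andP; split; last first.
    by apply/orP; right; apply/bigcupP; exists i.
  apply/negP => /imsetP[j _ xj]; have := subsetP (out_nbrs (f i)) x xo; rewrite in_nbrs xj => aij.
  have [ij|ij] := eqVneq i j; first by rewrite ij adj_irrefl in aij.
  by have := light_heavy fl ij; rewrite /heavy aij orbT.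
have leE w : \sum_(y in Y) \sum_(f in light y) hits (S w) y f <= q ^ q * #|caught (S w)|.
  rewrite mulnC -sum_nat_const [X in _ <= X]big_mkcond [X in X <= _]big_mkcond /=.
  apply: leq_sum => y _; case: ifP => yY //; case: ifP => yC; last first.
    rewrite big1 // => f fl; case: (boolP (hits (S w) y f)) => // h.
    by move: yC; rewrite inE yY /=; case/existsP; exists f.
  have := yC; rewrite inE yY => /existsP[f0 /and3P[fl0 /eqP fS0 _]].
  have -> : q ^ q = #|[set f : {ffun 'I_q -> G} | f \in ffun_on (mem (nbrs y :&: S w))]|.
    rewrite cardsE card_ffun_on card_ord fS0 card_imset ?card_ord //; exact: light_inj fl0.
  rewrite -sum1_card [X in _ <= X]big_mkcond [X in X <= _]big_mkcond; apply: leq_sum => f _.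
  case: ifP => // fl; case: (boolP (hits _ _ _)) => // /and3P[_ /eqP fS _].
  rewrite inE ifT //; apply/ffun_onP => i; rewrite fS; exact: imset_f.
have T_gt0 : 0 < T by rewrite expn_gt0.
rewrite -(leq_pmul2r T_gt0).
have le1 : (\sum_(y in Y) #|light y|) * T <=
    2 * N.+1 ^ q * \sum_w \sum_(y in Y) \sum_(f in light y) hits (S w) y f.
  rewrite exchange_big big_distrl big_distrr /=; apply: leq_sum => y yY.
  rewrite exchange_big -sum1_card big_distrl big_distrr /=; apply: leq_sum => f fl.
  rewrite mul1n; apply: leq_trans (hit_prob y f yY fl) _; rewrite leq_mul2l; apply/orP; right.
  rewrite -sum1_card big_mkcond; apply: leq_sum => w _; rewrite inE; by case: hits.
apply: leq_trans le1 _.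
apply: leq_trans (_ : 2 * N.+1 ^ q * (q ^ q * ((D + q * q * (L * D)).+1 * \sum_w #|S w|)) <= _).
  rewrite leq_mul2l; apply/orP; right; rewrite big_distrr big_distrr /=; apply: leq_sum => w _.
  by apply: leq_trans (leE w) _; rewrite leq_mul2l card_caught ?orbT.
have -> : 2 * N.+1 ^ q * (q ^ q * ((D + q * q * (L * D)).+1 * \sum_w #|S w|)) =
    2 * q ^ q * N.+1 ^ k * (D + q * q * (L * D)).+1 * (#|X| * T).
  by rewrite -sumS [N.+1 ^ q]expnS; lia.
rewrite mulnA leq_mul2r; apply/orP; right; rewrite leq_mul2r; apply/orP; right.
have -> : D ^ q = D * D ^ k by rewrite /q expnS.
rewrite NE expnMn.
have leD : (D + q * q * (L * D)).+1 <= (2 + q * q * L) * D by lia.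
apply: leq_trans (_ : 2 * q ^ q * ((2 * (a + q)) ^ k * D ^ k) * ((2 + q * q * L) * D) <= _).
  by rewrite leq_mul2l leD orbT.
lia.
Qed.
End FewSpreadMaps.

Lemma few_light_maps (G : sgraph) (D k L a : nat) (Y X : {set G}) : 0 < D ->
  (forall U : {set G}, arcs U U <= D * #|U|) -> c4free_bounded G k ->
  [disjoint Y & X] -> (forall y, y \in Y -> #|nbrs y :&: X| <= a * D) ->
  \sum_(y in Y) #|spread_maps (heavy Y (L * D)) k.+1 (nbrs y :&: X)| <=
  (2 * k.+1 ^ k.+1 * (2 + k.+1 * k.+1 * L) * (2 * (a + k.+1)) ^ k) * D ^ k.+1 * #|X|.
Proof.
move=> D_gt0 arcsD c4k disYX degY; have [out [outN outP]] := orientation arcsD.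
by apply: (@sum_light G D k L a Y X _ _ _ _ _ out) => // v; have [] := outN v.
Qed.

(** * Many tuples with large common neighbourhood *)

(** The form in which sparsity of all vertex sets of size about D is used: it
bounds the number of vertices with a large neighbourhood in Z even when Z is much
larger than D. *)
Definition locally_sparse (G : sgraph) D P := forall Z : {set G},
  D <= P * #|Z| -> P * #|[set b | #|Z| <= P * #|nbrs b :&: Z|]| <= D.

Lemma locally_sparse_le (G : sgraph) D P P' :
  P <= P' -> locally_sparse G D P' -> locally_sparse G D P.
Proof.
move=> leP sp Z leD; apply: leq_trans (sp Z _); last by apply: leq_trans leD _; rewrite leq_mul2r leP orbT.
apply: leq_mul => //; apply: subset_leq_card; apply/subsetP => b; rewrite !inE => le.
by apply: leq_trans le _; rewrite leq_mul2r leP orbT.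
Qed.

Definition common (G : sgraph) (Y : {set G}) n (f : {ffun 'I_n -> G}) :=
  [set y in Y | [forall i, adj y (f i)]].

(** The number of pairs of a vertex y of Y and an n-tuple of neighbours of y in X
that has pairwise non-adjacent entries with at least D common neighbours in Y. *)
Definition rich_stars (G : sgraph) D n (Y X : {set G}) :=
  \sum_(f in spread_maps (@adj G) n X | D <= #|common Y f|) #|common Y f|.

Section Step.
Variables (G : sgraph) (D : nat) (Y X : {set G}).

(** The pair to which the argument is applied again after b has been chosen as
first entry of a tuple consists of [rich_nbrs m p b] and [partners m b]. *)
Definition partners m b : {set G} :=
  [set b' in X | ~~ adj b b' && (m < #|nbrs b :&: nbrs b' :&: Y|)].

Definition rich_nbrs m p b : {set G} :=
  [set y in Y | adj y b && (D <= p * #|nbrs y :&: partners m b|)].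

Lemma rich_starsS n m p :
  \sum_(b in X) rich_stars D n (rich_nbrs m p b) (partners m b) <= rich_stars D n.+1 Y X.
Proof.
rewrite [leqRHS]big_mkcondr /= [leqRHS]big_mkcond sum_fcons [leqLHS]big_mkcond /=.
apply: leq_sum => b _; case: ifP => bX //; rewrite /rich_stars big_mkcondr /= big_mkcond.
apply: leq_sum => g _; case: ifP => // gsp; case: ifP => // leD.
have sub : common (rich_nbrs m p b) g \subset common Y (fcons b g).
  apply/subsetP => y; rewrite !inE (forall_fcons _ _ (adj y)) => /andP[/andP[-> /andP[-> _]] ->].
  by [].
have -> : fcons b g \in spread_maps (@adj G) n.+1 X.
  move: gsp; rewrite !inE (forall_fcons _ _ (mem X)) /= bX (spread_fcons _ _ (@adj_sym G)).
  case/andP=> /forallP gP ->; rewrite andbT; apply/andP; split; apply/forallP => i;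
    by have := gP i; rewrite !inE => /and3P[].
by rewrite ifT ?(leq_trans leD) // subset_leq_card.
Qed.

Lemma sum_rich_nbrs m p :
  \sum_(b in X) #|rich_nbrs m p b| =
  \sum_(y in Y) #|[set b in nbrs y :&: X | D <= p * #|nbrs y :&: partners m b|]|.
Proof.
under eq_bigr => b _ do rewrite -sum1_card big_mkcond /=.
under [RHS]eq_bigr => b _ do rewrite -sum1_card big_mkcond /=.
rewrite exchange_big /= [RHS]big_mkcond; apply: eq_bigr => y _ /=.
case: ifP => yY; last by rewrite big1 // => b _; rewrite inE yY.
rewrite big_mkcond; apply: eq_bigr => b _ /=; rewrite !inE yY /=.
by case: (b \in X); rewrite ?andbF // andbT.
Qed.

(** Each partner of b sends more than m arcs into the neighbourhood of b; so this
neighbourhood together with the partners is unbalanced if m is large compared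
with a D. *)
Lemma card_partners a m b :
  (forall y, y \in Y -> #|nbrs y :&: X| <= a * D) ->
  m * #|partners m b| <= a * D * #|nbrs b :&: Y|.
Proof.
move=> degY; apply: leq_trans (_ : arcs (partners m b) (nbrs b :&: Y) <= _).
  apply: arcs_ge => b'; rewrite inE => /and3P[_ _ /ltnW le]; apply: leq_trans le _.
  by rewrite setIA (setIC (nbrs b)).
rewrite arcsC; apply: arcs_le => y /setIP[_ yY]; apply: leq_trans (degY y yY).
by apply/subset_leq_card/setIS/subsetP => z; rewrite inE => /andP[].
Qed.

(** If few neighbours b of y have many partners around y, then at least half
of them are heavy to few neighbours of y: heaviness comes from equality, from adjacency,
which local sparsity bounds, or from being a partner.  Choosing only among them
gives a positive proportion of tuples of pairwise light neighbours. *)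
Lemma light_or_rich k p P m y : 0 < k -> 0 < p -> y \in Y -> locally_sparse G D P ->
  D <= p * #|nbrs y :&: X| -> 16 * k * p <= D -> 16 * k <= P -> 4 * p <= P ->
  (D ^ k <= (4 * p) ^ k * #|spread_maps (heavy Y m) k (nbrs y :&: X)|) \/
  (D <= 4 * p * #|[set b in nbrs y :&: X | D <= (16 * k * p) * #|nbrs y :&: partners m b|]|).
Proof.
move=> k_gt0 p_gt0 yY sp leD D_large P1 P2; set M := nbrs y :&: X in leD *; set R := [set b in M | _].
pose pop := [set b | #|M| <= P * #|nbrs b :&: M|].
have le_pop : P * #|pop| <= D.
  by apply: sp; apply: leq_trans leD _; rewrite leq_mul2r; apply/orP; right; lia.
pose U := [set b in M | (b \notin pop) && (b \notin R)].
have cM : #|M| <= #|U| + #|pop| + #|R|.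
  have sub : M \subset U :|: pop :|: R.
    by apply/subsetP => b bM; rewrite 2!inE [b \in U]inE bM; case: (b \in pop); case: (b \in R).
  by apply: leq_trans (subset_leq_card sub) _; rewrite !(leq_trans (leq_card_setU _ _)) ?leq_add2r ?leq_card_setU.
have M_ge : 16 * k <= #|M|.
  by rewrite -(@leq_pmul2r p) //; apply: leq_trans D_large _; rewrite mulnC.
(* Each of the three sources of heaviness contributes at most #|M| / (16 k). *)
pose E := (3 * #|M|) %/ (16 * k).
have E_le : 16 * k * E <= 3 * #|M| by rewrite mulnC leq_divM.
have lowU b : b \in U -> #|[set b' in U | heavy Y m b b']| <= E.
  rewrite inE => /and3P[bM bpop bR].
  have sub : [set b' in U | heavy Y m b b'] \subset
      [set b] :|: (nbrs b :&: M) :|: (nbrs y :&: partners m b).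
    apply/subsetP => b'; rewrite 2!inE => /andP[/andP[b'M _]] /or3P[/eqP->|abb'|cod].
    - by rewrite !inE eqxx.
    - by rewrite !inE abb' -in_nbrs; move: b'M; rewrite !inE => /andP[-> ->]; rewrite !orbT.
    - have := b'M; rewrite !inE => /andP[-> ->]; rewrite cod /=.
      by case: (adj b b'); rewrite ?orbT ?andbT.
  have le1 : #|[set b' in U | heavy Y m b b']| <=
      1 + #|nbrs b :&: M| + #|nbrs y :&: partners m b|.
    apply: leq_trans (subset_leq_card sub) _.
    apply: leq_trans (leq_card_setU _ _) _; rewrite leq_add2r.
    by apply: leq_trans (leq_card_setU _ _) _; rewrite leq_add2r cards1.
  apply: leq_trans le1 _; rewrite leq_divRL ?muln_gt0 //.
  have h1 : 16 * k * #|nbrs b :&: M| <= #|M|.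
    move: bpop; rewrite inE -ltnNge => /ltnW; apply: leq_trans.
    by rewrite leq_mul2r P1 orbT.
  have h2 : 16 * k * #|nbrs y :&: partners m b| <= #|M|.
    move: bR; rewrite inE bM /= -ltnNge => lt; rewrite -(@leq_pmul2r p) //.
    apply: leq_trans (_ : D <= _); last by rewrite mulnC.
    by rewrite mulnAC; apply: ltnW.
  lia.
have le_pop4 : 4 * #|pop| <= #|M|.
  rewrite -(@leq_pmul2r p) //; apply: leq_trans (_ : D <= _); last by rewrite mulnC.
  by apply: leq_trans le_pop; rewrite mulnAC leq_mul2r P2 orbT.
have [Ule|Ugt] := leqP #|M| (2 * #|U|); [left|right].
  have leS : (#|U| - k * E) ^ k <= #|spread_maps (heavy Y m) k M|.
    apply: leq_trans (card_spread_maps_ge _ (heavy_sym Y m) lowU) _.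
    apply: subset_leq_card; apply/subsetP => f; rewrite !inE => /andP[/forallP fU ->].
    by rewrite andbT; apply/forallP => i; have := fU i; rewrite inE => /andP[].
  apply: leq_trans (_ : (4 * p) ^ k * (#|U| - k * E) ^ k <= _); last by rewrite leq_mul2l leS orbT.
  rewrite -expnMn; apply: leq_expl; apply: leq_trans leD _.
  by rewrite (mulnC 4) -mulnA leq_mul2l; apply/orP; right; lia.
by apply: leq_trans leD _; rewrite (mulnC 4) -mulnA leq_mul2l; apply/orP; right; lia.
Qed.
End Step.

(** Induction on n.  By [few_light_maps], in an unbalanced pair the first
alternative of [light_or_rich] fails for at least half of Y, so by double
counting many b are such that a fixed proportion of the neighbours of b sees many
partners of b.  For these b the pair formed by such neighbours and the partners
is again unbalanced. *)
Lemma rich_stars_ge a k n p : exists K g P D0, forall (G : sgraph) D (Y X : {set G}),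
  D0 <= D -> (forall U : {set G}, arcs U U <= D * #|U|) -> c4free_bounded G k ->
  locally_sparse G D P -> [disjoint Y & X] ->
  (forall y, y \in Y -> #|nbrs y :&: X| <= a * D) ->
  (forall y, y \in Y -> D <= p * #|nbrs y :&: X|) ->
  K * #|X| <= #|Y| -> D ^ n * #|Y| <= g * rich_stars D n Y X.
Proof.
elim: n p => [|n IHn] p.
  exists p, 1, 0, 0 => G D Y X _ _ _ _ _ _ degY leK; rewrite expn0 !mul1n.
  have [->|[y yY]] := set_0Vmem Y; first by rewrite cards0.
  have leY : D <= #|Y|.
    apply: leq_trans (degY y yY) _; apply: leq_trans leK; rewrite leq_mul2l.
    by rewrite subset_leq_card ?orbT // subsetIr.
  have /card_gt0P[f _] : 0 < #|{: {ffun 'I_0 -> G}}| by rewrite card_ffun card_ord.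
  have cY : common Y f = Y.
    apply/setP => z; rewrite inE; case: (z \in Y) => //=; apply/forallP; case=> //.
  rewrite /rich_stars (bigD1 f) /= ?cY ?leq_addr // leY andbT inE.
  by apply/andP; split; apply/forallP; case.
pose q := k.+1; pose p' := 16 * q * p.
have [K [g [P [D0 IH]]]] := IHn p'.
(* Q bounds the loss when passing from the neighbours of b to the rich ones; L is
   then large enough for the new pair to have ratio K. *)
pose Q := 16 * p * a.+1; pose L := a.+1 * Q * K.
pose C := 2 * q ^ q * (2 + q * q * L) * (2 * (a + q)) ^ k.
exists (2 * ((4 * p) ^ q * C)), (16 * p * g), (P + 16 * q + 4 * p), (D0 + p' + 1).
move=> G D Y X D_large arcsD c4k sp disYX degY richY leK.
have D_gt0 : 0 < D by lia.
have [->|[y0 y0Y]] := set_0Vmem Y; first by rewrite cards0 muln0.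
have p_gt0 : 0 < p by case: (p) (richY y0 y0Y) => //; lia.
pose light y := spread_maps (heavy Y (L * D)) q (nbrs y :&: X).
pose rich y := [set b in nbrs y :&: X | D <= p' * #|nbrs y :&: partners Y X (L * D) b|].
pose bad := [set y in Y | D ^ q <= (4 * p) ^ q * #|light y|].
have le_bad : 2 * #|bad| <= #|Y|.
  apply: leq_trans leK; rewrite -mulnA leq_mul2l /=.
  rewrite -(@leq_pmul2r (D ^ q)) ?expn_gt0 ?D_gt0 //.
  apply: leq_trans (_ : (4 * p) ^ q * \sum_(y in Y) #|light y| <= _).
    rewrite -sum_nat_const big_distrr /= [leqRHS](big_setID bad) /=.
    apply: leq_trans (leq_addr _ _); rewrite (setIidPr _); last first.
      by apply/subsetP => y; rewrite inE => /andP[].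
    by apply: leq_sum => y; rewrite inE => /andP[].
  have le := few_light_maps L D_gt0 arcsD c4k disYX degY.
  have eqC : (4 * p) ^ q * C * #|X| * D ^ q = (4 * p) ^ q * (C * D ^ q * #|X|).
    by move: (C) => C'; rewrite mulnAC !mulnA.
  by rewrite eqC leq_mul2l le orbT.
have rich_good y : y \in Y :\: bad -> D <= 4 * p * #|rich y|.
  rewrite inE inE => /andP[ybad yY]; rewrite yY /= in ybad.
  have [|||le|//] := @light_or_rich G D Y X q p (P + 16 * q + 4 * p) (L * D) y isT p_gt0 yY sp (richY y yY).
  - by rewrite -/p'; lia.
  - lia.
  - lia.
  by rewrite le in ybad.
pose Yb := rich_nbrs D Y X (L * D) p'; pose Xb := partners Y X (L * D).
have sum1 : D * #|Y| <= 8 * p * \sum_(b in X) #|Yb b|.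
  rewrite sum_rich_nbrs -/rich.
  have le1 : D * #|Y :\: bad| <= 4 * p * \sum_(y in Y) #|rich y|.
    rewrite mulnC -sum_nat_const big_distrr /= [leqRHS](big_setID (Y :\: bad)) /=.
    apply: leq_trans (leq_addr _ _); rewrite (setIidPr (subsetDl _ _)).
    by apply: leq_sum => y /rich_good.
  have cY : #|Y| <= 2 * #|Y :\: bad|.
    by have := cardsID bad Y; have := subset_leq_card (subsetIr Y bad); lia.
  apply: leq_trans (_ : D * (2 * #|Y :\: bad|) <= _); first by rewrite leq_mul2l cY orbT.
  move: le1; move: (\sum_(y in Y) #|rich y|) => sr; lia.
pose good := [set b in X | #|nbrs b :&: Y| <= Q * #|Yb b|].
have sum2 : 16 * p * \sum_(b in X :\: good) #|Yb b| <= D * #|Y|.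
  rewrite -(@leq_pmul2r a.+1) // mulnAC -/Q.
  apply: leq_trans (_ : arcs X Y <= _).
    rewrite /arcs big_distrr /= [leqRHS](big_setID (X :\: good)) /=.
    apply: leq_trans (leq_addr _ _); rewrite (setIidPr (subsetDl _ _)).
    by apply: leq_sum => b; rewrite inE inE => /andP[] + bX; rewrite bX /= -ltnNge => /ltnW.
  by rewrite arcsC; apply: leq_trans (arcs_le degY) _; lia.
have sum3 : D * #|Y| <= 16 * p * \sum_(b in good) #|Yb b|.
  have sgX : good \subset X by apply/subsetP => b; rewrite inE => /andP[].
  by move: sum1; rewrite (big_setID good) /= (setIidPr sgX); lia.
apply: leq_trans (_ : 16 * p * g * \sum_(b in X) rich_stars D n (Yb b) (Xb b) <= _); last first.
  by rewrite leq_mul2l rich_starsS orbT.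
apply: leq_trans (_ : 16 * p * \sum_(b in good) D ^ n * #|Yb b| <= _).
  rewrite expnS -big_distrr /= mulnAC mulnC [leqRHS]mulnCA leq_mul2l; apply/orP; right.
  exact: sum3.
rewrite -[leqRHS]mulnA leq_mul2l; apply/orP; right; rewrite big_distrr /=.
rewrite [leqRHS](big_setID good) /=; apply: leq_trans (leq_addr _ _).
have sgX : good \subset X by apply/subsetP => b; rewrite inE => /andP[].
rewrite (setIidPr sgX); apply: leq_sum => b; rewrite inE => /andP[bX bgood].
have sYb : Yb b \subset Y by apply/subsetP => y; rewrite inE => /andP[].
have sXb : Xb b \subset X by apply/subsetP => y; rewrite inE => /andP[].
apply: IH => //.
- lia.
- by apply: locally_sparse_le sp; lia.
- exact: disjointWl sYb (disjointWr sXb disYX).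
- move=> y /(subsetP sYb)/degY; apply: leq_trans; exact/subset_leq_card/setIS.
- by move=> y; rewrite inE => /and3P[].
have := card_partners (L * D) b degY; rewrite -/(Xb b) => le.
have Q_gt0 : 0 < a.+1 * Q by rewrite !muln_gt0 p_gt0.
rewrite -(@leq_pmul2l (a.+1 * Q)) // mulnA -/L.
rewrite -(@leq_pmul2r D) // mulnAC; apply: leq_trans le _.
rewrite mulnAC leq_mul2r; apply/orP; right.
by rewrite -mulnA; apply: leq_mul.
Qed.

(** * The case of bounded degrees *)
Section BoundedDegree.
Variables (G : sgraph) (D M k P : nat) (Q : {set G}).
Hypothesis c4k : c4free_bounded G k.
Hypothesis sp : locally_sparse G D P.
Hypothesis degQ : forall x, x \in Q -> #|nbrs x :&: Q| <= M * D.

Definition middle (u : G * G) : {set G} := nbrs u.1 :&: nbrs u.2 :&: Q.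

(** The quadruple ((x0, x2), (x1, x3)) stands for the cycle x0 x1 x2 x3, so that
a cycle is a pair of opposite vertices and a pair of their common neighbours. *)
Definition four_cycles : {set (G * G) * (G * G)} :=
  [set p | [&& p.1.1 \in Q, p.1.2 \in Q, p.1.1 != p.1.2, p.2.1 != p.2.2,
            p.2.1 \in middle p.1 & p.2.2 \in middle p.1]].

Definition verts (p : (G * G) * (G * G)) : {set G} := [set p.1.1; p.1.2; p.2.1; p.2.2].

Lemma card_verts p : p \in four_cycles -> #|verts p| = 4.
Proof.
case: p => -[x0 x2] [x1 x3]; rewrite !inE /= => /and5P[_ _ n02 n13 /andP[/andP[/andP[a01 a21] _] /andP[/andP[a03 a23] _]]].
have neq (x y : G) : adj x y -> x != y by apply: contraTneq => ->; rewrite adj_irrefl.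
have -> : verts ((x0, x2), (x1, x3)) = [set z in [:: x0; x2; x1; x3]].
  by apply/setP => z; rewrite !inE /= !orbA.
rewrite cardsE; apply/card_uniqP; rewrite /= !inE !negb_or n02 n13 (neq _ _ a01) (neq _ _ a03).
by rewrite (neq _ _ a21) (neq _ _ a23).
Qed.

(** For fixed x0, the sum of squared codegrees is small: by local sparsity at most
D/P vertices have a codegree above a P-th of the degree of x0, and the
contribution of the others is at most that fraction of the number of paths of
length two. *)
Lemma card_four_cycles : P * #|four_cycles| <= (M ^ 2 + M ^ 3) * D ^ 3 * #|Q|.
Proof.
apply: leq_trans (_ : P * \sum_(x0 in Q) \sum_(x2 in Q) #|middle (x0, x2)| ^ 2 <= _).
  have -> : #|four_cycles| = \sum_u \sum_v (if (u, v) \in four_cycles then 1 else 0).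
    rewrite -sum1_card big_mkcond pair_bigA; by apply: eq_bigr => -[u v].
  rewrite leq_mul2l; apply/orP; right.
  rewrite [X in _ <= X]pair_big [X in _ <= X]big_mkcond /=.
  apply: leq_sum => -[x0 x2] _ /=; case: ifP => [xQ|xQ]; last first.
    rewrite big1 // => v _; rewrite !inE /=.
    by move: xQ; case: (x0 \in Q); case: (x2 \in Q).
  rewrite -mulnn -cardsX -sum1_card [leqRHS]big_mkcond; apply: leq_sum => v _.
  by case: ifP => //; rewrite inE /= => /and5P[_ _ _ _ /andP[h1 h2]]; rewrite inE h1 h2.
rewrite [leqRHS]mulnC -sum_nat_const big_distrr /=; apply: leq_sum => x0 x0Q.
pose Z := nbrs x0 :&: Q.
have midE x2 : middle (x0, x2) = nbrs x2 :&: Z by rewrite /middle /= setIAC setIC.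
under eq_bigr => x2 _ do rewrite midE.
have sumZ : \sum_(x2 in Q) #|nbrs x2 :&: Z| <= (M * D) ^ 2.
  apply: leq_trans (_ : arcs Z Q <= _); first by rewrite arcsC.
  apply: leq_trans (arcs_le (_ : forall z, z \in Z -> #|nbrs z :&: Q| <= M * D)) _.
    by move=> z /setIP[_ /degQ].
  by rewrite -mulnn leq_mul2l degQ ?orbT.
have leZ x2 : #|nbrs x2 :&: Z| <= M * D.
  by apply: leq_trans (degQ x0Q); rewrite subset_leq_card // subsetIr.
have [leD|ltD] := leqP D (P * #|Z|).
  pose R := [set b | #|Z| <= P * #|nbrs b :&: Z|].
  rewrite (big_setID R) /= mulnDr mulnDl leq_add //.
    apply: leq_trans (_ : P * (#|R| * (M * D) ^ 2) <= _).
      rewrite leq_mul2l -sum_nat_const; apply/orP; right.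
      rewrite big_mkcond [leqRHS]big_mkcond; apply: leq_sum => x2 _ /=.
      rewrite [_ \in _ :&: _]inE; case: ifP => [/andP[_ ->]|_]; last by case: ifP.
      by rewrite leq_exp2r.
    rewrite mulnA; apply: leq_trans (leq_mul (sp leD) (leqnn _)) _; lia.
  apply: leq_trans (_ : \sum_(x2 in Q :\: R) (M * D) * #|nbrs x2 :&: Z| <= _).
    rewrite big_distrr /=; apply: leq_sum => x2; rewrite inE inE -ltnNge => /andP[lt _].
    rewrite -mulnn mulnA leq_mul2r; apply/orP; right; apply: leq_trans (ltnW lt) _.
    exact: degQ.
  rewrite -big_distrr /=; apply: leq_trans (_ : (M * D) * (M * D) ^ 2 <= _); last by lia.
  rewrite leq_mul2l; apply/orP; right; apply: leq_trans sumZ.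
  by rewrite [leqRHS](big_setID (Q :\: R)) /= (setIidPr (subsetDl _ _)) leq_addr.
apply: leq_trans (_ : D * (M * D) ^ 2 <= _); last by lia.
apply: leq_trans (_ : D * \sum_(x2 in Q) #|nbrs x2 :&: Z| <= _); last by rewrite leq_mul2l sumZ orbT.
rewrite !big_distrr /=; apply: leq_sum => x2 _; rewrite -mulnn mulnA leq_mul2r; apply/orP; right.
apply: leq_trans (ltnW ltD); rewrite leq_mul2l; apply/orP; right.
by rewrite subset_leq_card // subsetIr.
Qed.

Section Sample.
Variable S : {set G}.
Hypothesis sSQ : S \subset Q.

(** One vertex of every sampled four-cycle is deleted, at the cost of the arcs at
that vertex. *)
Lemma arcs_sample : arcs S S <=
  k * #|S| + 2 * \sum_(p in four_cycles | verts p \subset S) #|nbrs p.1.1 :&: S|.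
Proof.
pose B := [set x in S | [exists p, [&& p \in four_cycles, verts p \subset S & p.1.1 == x]]].
have sBS : B \subset S by apply/subsetP => x; rewrite inE => /andP[].
have free : c4free (S :\: B).
  move=> x0 x1 x2 x3 /setDP[x0S x0B] /setDP[x1S _] /setDP[x2S _] /setDP[x3S _] a01 a12 a23 a30 n02 n13.
  move: x0B; rewrite inE x0S /= => /existsP[]; exists ((x0, x2), (x1, x3)) => /=.
  have SQ := subsetP sSQ.
  rewrite !inE !SQ //= n02 n13 a01 a23 (adj_sym x2) a12 (adj_sym x0) a30 eqxx /= andbT.
  by apply/subsetP => z; rewrite !inE => /orP[/orP[/orP[]|]|] /eqP->.
rewrite (arcsDl _ sBS) [arcs (S :\: B) S](arcsDr _ sBS) addnA.
apply: leq_trans (_ : 2 * arcs B S + k * #|S :\: B| <= _).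
  rewrite mul2n -addnn; apply: leq_add; last exact: c4k.
  by rewrite leq_add2l arcsC arcsS // subsetDl.
rewrite addnC leq_add //; first by rewrite leq_mul2l subset_leq_card ?orbT // subsetDl.
rewrite leq_mul2l /= (partition_big (fun p => p.1.1) xpredT) //= /arcs big_mkcond /=.
apply: leq_sum => x _; case: ifP => //; rewrite inE => /andP[_ /existsP[p /and3P[pC pS /eqP px]]].
by rewrite (bigD1 p) /= ?px ?leq_addr // pC pS eqxx.
Qed.
End Sample.

(** Expectation of [arcs_sample].  A vertex next to x0 outside the cycle makes a
set of five vertices; the four vertices of the cycle itself account for the
term 4. *)
Lemma arcs_average N : N.+1 <= D ->
  arcs Q Q * N.+1 ^ 3 <= k * #|Q| * N.+1 ^ 4 + 2 * #|four_cycles| * ((M + 4) * D).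
Proof.
move=> leND.
pose S (w : {ffun G -> 'I_N.+1}) := [set x in Q | w x == ord0].
have sSQ w : S w \subset Q by apply/subsetP => x; rewrite inE => /andP[].
pose T := N.+1 ^ #|G|; have T_gt0 : 0 < T by rewrite expn_gt0.
have inS w x : x \in Q -> (x \in S w) = (w x == ord0) by move=> xQ; rewrite inE xQ.
have subS w (U : {set G}) : U \subset Q -> (U \subset S w) = (w \in zero_on N U).
  move=> sUQ; rewrite inE; apply/subsetP/forall_inP => h x xU; first by rewrite -inS ?h ?(subsetP sUQ).
  by rewrite inS ?h ?(subsetP sUQ).
have sumU (U : {set G}) : U \subset Q -> (\sum_w (U \subset S w)) * N.+1 ^ #|U| = T.
  move=> sUQ; rewrite /T -(card_zero_on N U); congr (_ * _); rewrite -sum1_card [RHS]big_mkcond.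
  by apply: eq_bigr => w _; rewrite subS //; case: (w \in _).
have sum1 : (\sum_w #|S w|) * N.+1 = #|Q| * T.
  have -> : \sum_w #|S w| = \sum_(x in Q) \sum_w ([set x] \subset S w).
    rewrite exchange_big; apply: eq_bigr => w _; rewrite -sum1_card big_mkcond [RHS]big_mkcond.
    by apply: eq_bigr => x _; rewrite sub1set inE; case: (x \in Q); case: (w x == ord0).
  rewrite big_distrl -sum_nat_const; apply: eq_bigr => x xQ /=.
  by have := sumU [set x]; rewrite sub1set cards1 expn1; apply.
have sum2 : (\sum_w arcs (S w) (S w)) * N.+1 ^ 2 = arcs Q Q * T.
  have -> : \sum_w arcs (S w) (S w) = \sum_(x in Q) \sum_(y in nbrs x :&: Q) \sum_w ([set x; y] \subset S w).
    under [RHS]eq_bigr => x _ do rewrite exchange_big.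
    rewrite [RHS]exchange_big; apply: eq_bigr => w _; rewrite /arcs big_mkcond [RHS]big_mkcond.
    apply: eq_bigr => x _; rewrite [x \in S w]inE; case: (boolP (x \in Q)) => xQ //=; case: ifP => wx.
      rewrite -sum1_card big_mkcond [RHS]big_mkcond; apply: eq_bigr => y _.
      rewrite !inE subUset !sub1set !inE xQ wx /=.
      by case: (adj x y); case: (y \in Q); case: (w y == ord0).
    by rewrite big1 // => y _; rewrite subUset sub1set inE wx andbF.
  rewrite /arcs !big_distrl; apply: eq_bigr => x xQ /=; rewrite big_distrl -sum_nat_const /=.
  apply: eq_bigr => y /setIP[]; rewrite in_nbrs => axy yQ.
  have nxy : x != y by apply: contraTneq axy => ->; rewrite adj_irrefl.
  by rewrite -(sumU [set x; y]) ?cards2 ?nxy // subUset !sub1set xQ.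
have sumC p : p \in four_cycles ->
    (\sum_(w | verts p \subset S w) #|nbrs p.1.1 :&: S w|) * N.+1 ^ 5 <= (M + 4) * D * T.
  move=> pC; have cp := card_verts pC.
  have vQ : verts p \subset Q.
    move: pC; rewrite !inE => /and5P[? ? _ _ /andP[/andP[_ ?] /andP[_ ?]]].
    by apply/subsetP => z; rewrite !inE => /orP[/orP[/orP[]|]|] /eqP->.
  have xQ : p.1.1 \in Q by apply: (subsetP vQ); rewrite !inE eqxx.
  have -> : \sum_(w | verts p \subset S w) #|nbrs p.1.1 :&: S w| =
      \sum_(v in nbrs p.1.1 :&: Q) \sum_w (v |: verts p \subset S w).
    rewrite exchange_big [LHS]big_mkcond; apply: eq_bigr => w _; case: ifP => vS; last first.
      by rewrite big1 // => v _; rewrite subUset vS andbF.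
    rewrite -sum1_card big_mkcond [RHS]big_mkcond; apply: eq_bigr => v _.
    by rewrite !inE subUset vS sub1set andbT inE; case: adj; case: (v \in Q); case: (w v == ord0).
  rewrite big_distrl /= (big_setID (verts p)) /= mulnDl mulnDl addnC; apply: leq_add.
    apply: leq_trans (_ : \sum_(v in nbrs p.1.1 :&: Q :\: verts p) T <= _).
      apply: leq_sum => v /setDP[/setIP[_ vQ'] vp].
      by rewrite -(sumU (v |: verts p)) ?cardsU1 ?vp ?cp // subUset sub1set vQ'.
    rewrite sum_nat_const leq_mul2r; apply/orP; right; apply: leq_trans (degQ xQ).
    by rewrite subset_leq_card // subsetDl.
  apply: leq_trans (_ : \sum_(v in verts p) T * N.+1 <= _).
    rewrite big_mkcond [leqRHS]big_mkcond; apply: leq_sum => v _; rewrite [v \in _ :&: verts p]inE andbC.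
    case: (boolP (v \in verts p)) => //= vp; case: ifP => // _.
    have -> : v |: verts p = verts p by apply/setUidPr; rewrite sub1set.
    by rewrite -(sumU (verts p)) // cp -mulnA -expnSr.
  by rewrite sum_nat_const cp -mulnA leq_mul2l /= [D * T]mulnC leq_mul2l leND orbT.
rewrite -(leq_pmul2r T_gt0).
have le0 : \sum_w arcs (S w) (S w) <= k * \sum_w #|S w| +
    2 * \sum_(p in four_cycles) \sum_(w | verts p \subset S w) #|nbrs p.1.1 :&: S w|.
  have -> : \sum_(p in four_cycles) \sum_(w | verts p \subset S w) #|nbrs p.1.1 :&: S w| =
      \sum_w \sum_(p in four_cycles | verts p \subset S w) #|nbrs p.1.1 :&: S w|.
    by rewrite (exchange_big_dep xpredT).
  by rewrite !big_distrr -big_split /=; apply: leq_sum => w _; apply: arcs_sample.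
have le1 : (\sum_(p in four_cycles) \sum_(w | verts p \subset S w) #|nbrs p.1.1 :&: S w|) * N.+1 ^ 5 <=
    #|four_cycles| * ((M + 4) * D * T).
  by rewrite big_distrl -sum_nat_const; apply: leq_sum => p /sumC.
have := leq_mul le0 (leqnn (N.+1 ^ 5)); rewrite mulnDl => le2.
apply: leq_trans (_ : (\sum_w arcs (S w) (S w)) * N.+1 ^ 5 <= _).
  by rewrite mulnAC -sum2 -mulnA -expnD.
apply: leq_trans le2 _; rewrite mulnDl; apply: leq_add.
  have -> : k * #|Q| * N.+1 ^ 4 * T = k * (N.+1 ^ 4 * (#|Q| * T)) by lia.
  by rewrite -sum1 -mulnA leq_mul2l; apply/orP; right; rewrite (expnS _ 4); lia.
by rewrite -mulnA; apply: leq_trans (leq_mul (leqnn 2) le1) _; rewrite !mulnA.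
Qed.
End BoundedDegree.

(** With sampling probability about K/D, the expected number of arcs exceeds k
times the expected size of the sample, and four-cycles are negligible because P
exceeds a large multiple of K^4. *)
Lemma bounded_degree_few_arcs M k c : exists P D0, forall (G : sgraph) D (Q : {set G}),
  D0 <= D -> c4free_bounded G k -> locally_sparse G D P ->
  (forall x, x \in Q -> #|nbrs x :&: Q| <= M * D) -> c * arcs Q Q <= D * #|Q|.
Proof.
pose K := c * k + 1.
pose C := 32 * c * (M + 4) * (M ^ 2 + M ^ 3) * K ^ 4.
exists C.+1, K => G D Q D_large c4k sp degQ; rewrite leqNgt; apply/negP => lt.
have K_gt0 : 0 < K by rewrite /K addn1.
have N_gt0 : 0 < D %/ K by rewrite divn_gt0.
pose N := (D %/ K).-1; have NE : N.+1 = D %/ K by rewrite prednK.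
have KN : N.+1 * K <= D by rewrite NE leq_divM.
have D2 : D <= 2 * K * N.+1.
  have := ltn_ceil D K_gt0; rewrite -NE; nia.
have ND : N.+1 <= D by apply: leq_trans KN; rewrite leq_pmulr.
have le1 := arcs_average c4k degQ ND.
have le2 := card_four_cycles sp degQ.
set q := #|Q| in lt le1 le2; set A := arcs Q Q in lt le1; set Th := #|_| in le1 le2.
set n := N.+1 in KN D2 le1; set X := q * n ^ 4.
have leK : K * X <= D * q * n ^ 3.
  have -> : K * X = n * K * (q * n ^ 3) by rewrite /X; lia.
  by rewrite -[D * q * _]mulnA leq_mul2r KN orbT.
have lt1 : D * q * n ^ 3 < c * (k * X + 2 * Th * ((M + 4) * D)).
  apply: leq_trans (_ : c * A * n ^ 3 <= _).
    by rewrite ltn_pmul2r ?expn_gt0.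
  by rewrite -mulnA leq_mul2l /X mulnA le1 orbT.
have D4 : D ^ 4 <= 16 * K ^ 4 * n ^ 4.
  by apply: leq_trans (leq_expl 4 D2) _; rewrite !expnMn.
have leC : C.+1 * (2 * c * Th * ((M + 4) * D)) <= C * X.
  apply: leq_trans (_ : 2 * c * (M + 4) * D * ((M ^ 2 + M ^ 3) * D ^ 3 * q) <= _).
    have -> : C.+1 * (2 * c * Th * ((M + 4) * D)) = 2 * c * (M + 4) * D * (C.+1 * Th).
      by move: (C.+1) => P; lia.
    by rewrite leq_mul2l le2 orbT.
  have -> : 2 * c * (M + 4) * D * ((M ^ 2 + M ^ 3) * D ^ 3 * q) =
      2 * c * (M + 4) * (M ^ 2 + M ^ 3) * q * D ^ 4 by rewrite (expnS D 3); lia.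
  apply: leq_trans (leq_mul (leqnn _) D4) _; rewrite /C /X; lia.
have lt2 : C.+1 * (K * X) < C.+1 * (c * k * X) + C.+1 * (2 * c * Th * ((M + 4) * D)).
  rewrite -mulnDr ltn_pmul2l //; apply: leq_ltn_trans leK (leq_trans lt1 _).
  by rewrite mulnDr !mulnA (mulnC c 2).
have := leq_trans lt2 (leq_add (leqnn _) leC).
have -> : K * X = c * k * X + X by rewrite /K mulnDl mul1n.
by rewrite mulnDr ltn_add2l; apply/negP; rewrite -leqNgt leq_mul2r leqnSn orbT.
Qed.

(** * Sparsity from bicliques, and an unbalanced pair *)
Definition biclique_in (G : sgraph) (W : {set G}) m := exists f g : 'I_m -> G,
  [/\ injective f, injective g, forall i, f i \in W, forall j, g j \in W & forall i j, adj (f i) (g j)].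

Definition dense_biclique (G : sgraph) q e := forall W : {set G},
  2 <= #|W| -> #|W| ^ 2 <= q * arcs W W -> exists2 m, #|W| <= e * m & biclique_in W m.

Lemma top_subset (T : finType) (f : T -> nat) (Z : {set T}) h : h <= #|Z| ->
  exists Z0 : {set T}, [/\ Z0 \subset Z, #|Z0| = h &
    h * \sum_(z in Z) f z <= #|Z| * \sum_(z in Z0) f z].
Proof.
have [n] := ubnP #|Z|; elim: n Z => // n IHn Z ltZn; rewrite leq_eqVlt => /orP[/eqP ->|lt_h].
  by exists Z; split.
have /card_gt0P[z0 z0Z] : 0 < #|Z| by apply: leq_trans lt_h.
pose z := [arg min_(i < z0 in Z) f i].
have [zZ zmin] : z \in Z /\ forall i, i \in Z -> f z <= f i by rewrite /z; case: arg_minnP.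
have cZ := cardsD1 z Z; rewrite zZ /= add1n in cZ.
have [||Z0 [sZ0 cZ0 le0]] := IHn (Z :\ z); try lia.
exists Z0; split=> //; first exact: subset_trans sZ0 (subD1set _ _).
have sumZ : \sum_(i in Z) f i = f z + \sum_(i in Z :\ z) f i by rewrite (big_setD1 z zZ).
have minZ : #|Z| * f z <= \sum_(i in Z) f i by rewrite -sum_nat_const; apply: leq_sum => i /zmin.
have [h0|h_gt0] := posnP h; first by rewrite h0 mul0n.
have c_gt0 : 0 < #|Z :\ z| by lia.
rewrite -(leq_pmul2l c_gt0).
move: le0 minZ; rewrite sumZ cZ; move: (\sum_(i in Z :\ z) f i) (\sum_(i in Z0) f i) => A B le0 minZ.
apply: leq_trans (_ : h * (#|Z :\ z|.+1 * A) <= _).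
  by rewrite mulnCA leq_mul2l; apply/orP; right; lia.
by rewrite mulnCA [leqRHS]mulnCA leq_mul2l /= le0.
Qed.

(** A violation would give sets R0 and Z0 of size h = D/P, with density at least
1/P between them, so that a biclique of size proportional to h, hence at least
s, would exist.  The set Z may be arbitrarily large; Z0 is the part of it with
most neighbours in R0. *)
Lemma locally_sparse_of_biclique_free (G : sgraph) D P e s : 0 < P ->
  dense_biclique G (4 * P) e -> (forall (W : {set G}) m, biclique_in W m -> m < s) ->
  P * (e * s + 2) <= D -> locally_sparse G D P.
Proof.
move=> P_gt0 dense small leD Z leZ; set R := [set b | _]; rewrite leqNgt; apply/negP => ltR.
pose h := D %/ P.
have hP : h * P <= D by apply: leq_divM.
have h_ge : e * s + 2 <= h by rewrite leq_divRL // mulnC.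
have hR : h <= #|R| by rewrite -(leq_pmul2l P_gt0) ltnW // mulnC; apply: leq_ltn_trans ltR.
have hZ : h <= #|Z| by rewrite -(leq_pmul2l P_gt0) mulnC (leq_trans hP).
have [R0 [sR0 cR0 _]] := top_subset (fun=> 0) hR.
have [Z0 [sZ0 cZ0 le0]] := top_subset (fun z => #|nbrs z :&: R0|) hZ.
rewrite -/(arcs Z R0) -/(arcs Z0 R0) in le0.
have le1 : #|Z| * h <= P * arcs Z R0.
  rewrite arcsC -cR0 /arcs big_distrr /= mulnC -sum_nat_const; apply: leq_sum => b /(subsetP sR0).
  by rewrite inE.
have Z_gt0 : 0 < #|Z| by lia.
have le2 : h ^ 2 <= P * arcs Z0 R0.
  rewrite -(leq_pmul2l Z_gt0); apply: leq_trans (_ : P * (h * arcs Z R0) <= _).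
    by rewrite -mulnn mulnA mulnC [leqRHS]mulnCA leq_mul2l le1 orbT.
  by rewrite [leqRHS]mulnCA leq_mul2l le0 orbT.
pose W := R0 :|: Z0.
have W_le : #|W| <= 2 * h by have [le _] := leq_card_setU R0 Z0; rewrite /W; lia.
have W_ge : h <= #|W| by rewrite -cR0 subset_leq_card ?subsetUl.
have [||m le_m bic] := dense W; first lia.
  have : arcs Z0 R0 <= arcs W W by apply: arcsS; rewrite ?subsetUl ?subsetUr.
  have := leq_mul W_le W_le; rewrite mulnn => leW leA.
  apply: leq_trans leW _; apply: leq_trans (_ : 4 * (P * arcs Z0 R0) <= _).
    by apply: leq_trans (leq_mul (leqnn 4) le2); lia.
  by rewrite -mulnA !leq_mul2l leA !orbT.
have := small _ _ bic; move=> lt_ms.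
have : e * m <= e * s by rewrite leq_mul2l ltnW ?orbT.
lia.
Qed.

(** X is the set H of vertices of degree above M D, which has at most |W|/M
elements.  Few arcs avoid H by hypothesis, few lie inside H or between H and the
vertices of degree above 64 D because these sets are small, and the remaining
arcs join H to vertices of degree at most 64 D. *)
Lemma unbalanced_pair (G : sgraph) D K (W : {set G}) :
  (forall U : {set G}, arcs U U <= D * #|U|) ->
  (forall Q : {set G}, (forall x, x \in Q -> #|nbrs x :&: Q| <= (512 * K.+1) * D) ->
     16 * arcs Q Q <= D * #|Q|) ->
  0 < D -> W != set0 -> D * #|W| <= 2 * arcs W W ->
  exists Y X : {set G}, [/\ Y != set0, [disjoint Y & X], K * #|X| <= #|Y|,
    forall y, y \in Y -> #|nbrs y :&: X| <= 64 * D &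
    forall y, y \in Y -> D <= 32 * #|nbrs y :&: X|].
Proof.
move=> arcsD bdeg D_gt0 W_neq0 denseW; set M := 512 * K.+1 in bdeg.
have high c : c * #|[set x in W | c * D < #|nbrs x :&: W|]| <= #|W|.
  set H := [set x in W | _]; rewrite -(leq_pmul2l D_gt0) mulnA (mulnC D).
  apply: leq_trans (arcsD W); apply: leq_trans (_ : arcs H W <= _).
    by apply: arcs_ge => x; rewrite inE => /andP[_ /ltnW].
  by apply: arcsS => //; apply/subsetP => x; rewrite inE => /andP[].
pose H := [set x in W | M * D < #|nbrs x :&: W|].
pose B := [set x in W | 64 * D < #|nbrs x :&: W|].
have leH : M * #|H| <= #|W| := high M.
have leB : 64 * #|B| <= #|W| := high 64.
have sHW : H \subset W by apply/subsetP => x; rewrite inE => /andP[].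
pose Q := W :\: H.
have leQ : 16 * arcs Q Q <= D * #|W|.
  apply: leq_trans (bdeg Q _) _.
    move=> x; rewrite inE [x \in H]inE => /andP[+ xW]; rewrite xW /= -leqNgt.
    by apply: leq_trans; rewrite subset_leq_card // setIS // subsetDl.
  by rewrite leq_mul2l subset_leq_card ?orbT // subsetDl.
have eqW : arcs W W = arcs H H + 2 * arcs Q H + arcs Q Q.
  rewrite (arcsDl _ sHW) (arcsDr _ sHW) [arcs (W :\: H) W](arcsDr _ sHW) -/Q (arcsC H Q); lia.
have leHH : 64 * arcs H H <= D * #|W|.
  apply: leq_trans (leq_mul (leqnn 64) (arcsD H)) _; rewrite mulnCA leq_mul2l; apply/orP; right.
  by apply: leq_trans leH; rewrite leq_mul2r /M; apply/orP; right; lia.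
pose Y1 := Q :\: B.
have leQB : 32 * arcs (Q :&: B) H <= D * #|W|.
  have leU : #|B :|: H| <= #|B| + #|H| by have [] := leq_card_setU B H.
  have le1 : arcs (Q :&: B) H <= D * (#|B| + #|H|).
    apply: leq_trans (_ : arcs (B :|: H) (B :|: H) <= _).
      by apply: arcsS; rewrite ?subsetUr // subIset ?subsetUl ?orbT.
    by apply: leq_trans (arcsD _) _; rewrite leq_mul2l leU orbT.
  apply: leq_trans (leq_mul (leqnn 32) le1) _; rewrite mulnCA leq_mul2l; apply/orP; right.
  have : 64 * #|H| <= #|W| by apply: leq_trans leH; rewrite leq_mul2r /M; apply/orP; right; lia.
  lia.
have eqQ : arcs Q H = arcs (Q :&: B) H + arcs Y1 H by rewrite /arcs (big_setID B).
pose Y := [set y in Y1 | D <= 32 * #|nbrs y :&: H|].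
have sYY1 : Y \subset Y1 by apply/subsetP => y; rewrite inE => /andP[].
have sY1W : Y1 \subset W by apply: subset_trans (subsetDl _ _) (subsetDl _ _).
have leYc : 32 * arcs (Y1 :\: Y) H <= D * #|W|.
  apply: leq_trans (_ : D * #|Y1 :\: Y| <= _).
    rewrite /arcs big_distrr /= mulnC -sum_nat_const; apply: leq_sum => y.
    by rewrite inE [y \in Y]inE => /andP[+ yY1]; rewrite yY1 /= -ltnNge => /ltnW.
  by rewrite leq_mul2l subset_leq_card ?orbT // (subset_trans (subsetDl _ _)).
have eqY : arcs Y1 H = arcs Y H + arcs (Y1 :\: Y) H by rewrite (arcsDl _ sYY1).
have degY y : y \in Y -> #|nbrs y :&: H| <= 64 * D.
  move=> /(subsetP sYY1); rewrite inE [y \in B]inE => /andP[+ /setDP[yW _]]; rewrite yW /= -leqNgt.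
  by apply: leq_trans; rewrite subset_leq_card // setIS.
have leY := arcs_le degY.
have leWY : #|W| <= 512 * #|Y|.
  rewrite -(leq_pmul2l D_gt0); move: denseW; rewrite eqW; lia.
exists Y, H; split=> //.
- by rewrite -card_gt0; move: leWY; rewrite -card_gt0 in W_neq0; lia.
- rewrite disjoint_subset; apply/subsetP => y /(subsetP sYY1); rewrite inE => /andP[_ /setDP[_ yH]].
  exact: yH.
- have : 512 * (K.+1 * #|H|) <= 512 * #|Y| by rewrite mulnA; apply: leq_trans leH leWY.
  by rewrite leq_pmul2l //; lia.
by move=> y; rewrite inE => /andP[].
Qed.

(** * Shattered tuples *)
Section Coordinate.
Variables (T : finType) (r : nat) (i : 'I_r).

Definition upd (f : {ffun 'I_r -> T}) x : {ffun 'I_r -> T} := [ffun j => if j == i then x else f j].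

Lemma updK f x : upd (upd f x) (f i) = f.
Proof. by apply/ffunP => j; rewrite !ffunE; case: eqP => [->|]. Qed.

Lemma upd_i f x : upd f x i = x. Proof. by rewrite ffunE eqxx. Qed.

(** Exchanging the entry f i with a further element of M is an involution on
pairs; so the entry behaves like a uniform element of M, independent of the
set Rel f. *)
Lemma card_coordinate (M : {set T}) (Rel : {ffun 'I_r -> T} -> {set T}) c q :
  (forall f x, Rel (upd f x) = Rel f) -> (forall f, c * #|Rel f| <= q) ->
  c * #|[set f : {ffun 'I_r -> T} | (f \in ffun_on (mem M)) && (f i \in Rel f)]| * #|M| <= q * #|M| ^ r.
Proof.
move=> RelE leq_; set B := [set f | _].
pose sw (p : {ffun 'I_r -> T} * T) := (upd p.1 p.2, p.1 i).
have sw_inv : involutive sw by move=> [f x]; rewrite /sw /= updK upd_i.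
pose E (p : {ffun 'I_r -> T} * T) := [&& p.1 \in ffun_on (mem M), p.2 \in M & p.2 \in Rel p.1].
have eqE : #|B| * #|M| = #|[set p | E p]|.
  rewrite -cardsX -(card_imset _ (inv_inj sw_inv)); apply: eq_card => p.
  apply/imsetP/idP => [[[f x] + ->]|].
    rewrite in_setX [_ \in B]inE /= => /andP[/andP[/ffun_onP fM fR] xM]; rewrite inE /E /= RelE fR fM andbT /=.
    by apply/andP; split=> //; apply/ffun_onP => j; rewrite ffunE; case: ifP => // _; apply: fM.
  rewrite inE => /and3P[/ffun_onP fM xM xR]; exists (sw p); last by rewrite sw_inv.
  rewrite in_setX [_ \in B]inE /= RelE upd_i xR fM !andbT.
  by apply/ffun_onP => j; rewrite ffunE; case: ifP => // _; apply: fM.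
rewrite -mulnA eqE.
apply: leq_trans (_ : \sum_(f in ffun_on (mem M)) c * #|Rel f| <= _); last first.
  rewrite mulnC -[r in _ ^ r]card_ord -card_ffun_on -sum_nat_const.
  by apply: leq_sum => f _.
rewrite -big_distrr leq_mul2l /=; apply/orP; right.
rewrite -sum1_card big_mkcond [leqRHS]big_mkcond /=.
have -> : \sum_i0 (if i0 \in [set p | E p] then 1 else 0) =
    \sum_(f : {ffun 'I_r -> T}) \sum_(x : T) (if E (f, x) then 1 else 0).
  by rewrite pair_bigA; apply: eq_bigr => -[f x] _; rewrite inE.
apply: leq_sum => f _; rewrite /E /=; case: ifP => fM; last by rewrite big1.
rewrite -sum1_card [leqRHS]big_mkcond; apply: leq_sum => x _ /=.
by case: (x \in M); case: (x \in Rel f).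
Qed.
End Coordinate.

Section Shatter.
Variables (G : sgraph) (D P : nat) (Y X : {set G}).

Definition commonI r (f : {ffun 'I_r -> G}) (I : {set 'I_r}) :=
  [set y in Y | [forall j in I, adj y (f j)]].

Definition unrelated r (f : {ffun 'I_r -> G}) := forall (I : {set 'I_r}) i, i \notin I ->
  P * #|nbrs (f i) :&: commonI f I| < #|commonI f I|.

(** Among the tuples counted by [rich_stars], those with an entry i related to the
common neighbourhood of the entries in I are rare: given the other entries, local
sparsity leaves at most D/P choices for that entry, whereas the hypothesis provides
of the order of D. *)
Lemma unrelated_star a r g : locally_sparse G D P -> 0 < D -> Y != set0 ->
  (forall y, y \in Y -> #|nbrs y :&: X| <= a * D) -> 0 < r ->
  D ^ r * #|Y| <= g * rich_stars D r Y X ->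
  g * (r * 2 ^ r * a ^ r) < P ->
  exists2 f : {ffun 'I_r -> G}, f \in spread_maps (@adj G) r X & D <= #|common Y f| /\ unrelated f.
Proof.
move=> sp D_gt0 Y_neq0 degY r_gt0 rich P_large.
pose rel (f : {ffun 'I_r -> G}) (p : 'I_r * {set 'I_r}) := [&& p.1 \notin p.2, D <= #|commonI f p.2| &
  #|commonI f p.2| <= P * #|nbrs (f p.1) :&: commonI f p.2|].
case: (pickP [pred f | [&& f \in spread_maps (@adj G) r X, D <= #|common Y f| & [forall p, ~~ rel f p]]]).
  move=> f /and3P[fX fD /forallP nrel]; exists f => //; split=> // I i iI.
  have := nrel (i, I); rewrite /rel /= iI /= negb_and -!ltnNge => /orP[lt|//].
  have := leq_trans lt fD; rewrite ltnNge => /negP[]; apply: subset_leq_card.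
  apply/subsetP => y; rewrite !inE => /andP[-> /forallP h]; apply/forallP => j; apply/implyP => _; exact: h.
move=> none.
have bound y p : y \in Y -> P * #|[set f : {ffun 'I_r -> G} | (f \in ffun_on (mem (nbrs y :&: X))) && rel f p]|
    <= a ^ r * D ^ r.
  move=> yY; case: p => i I; set M := nbrs y :&: X; set B := [set f | _].
  have [M0|M_gt0] := posnP #|M|.
    have -> : B = set0.
      apply/setP => f; rewrite inE in_set0; apply/negP => /andP[/ffun_onP/(_ i)].
      by rewrite (cards0_eq M0) inE.
    by rewrite cards0 muln0.
  have [iI|iI] := boolP (i \in I).
    have -> : B = set0 by apply/setP => f; rewrite !inE /rel /= iI andbF.
    by rewrite cards0 muln0.
  pose Rel (f : {ffun 'I_r -> G}) := if D <= #|commonI f I| then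
     [set b | #|commonI f I| <= P * #|nbrs b :&: commonI f I|] else set0.
  have comE f x : commonI (upd i f x) I = commonI f I.
    apply/setP => z; rewrite !inE; congr (_ && _); apply: eq_forallb_in => j jI.
    by rewrite ffunE; case: eqP jI => // ->; rewrite (negPf iI).
  have RelE f x : Rel (upd i f x) = Rel f by rewrite /Rel comE.
  have P_gt0 : 0 < P by apply: leq_ltn_trans P_large.
  have leR f : P * #|Rel f| <= D.
    rewrite /Rel; case: ifP => [leD|_]; last by rewrite cards0 muln0.
    by apply: sp; apply: leq_trans leD _; rewrite leq_pmull.
  have := card_coordinate M RelE leR.
  have -> : [set f | (f \in ffun_on (mem M)) && (f i \in Rel f)] = B.
    apply/setP => f; rewrite !inE /rel /= iI /Rel; congr (_ && _).
    by case: ifP => _; rewrite inE.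
  have powS x : x ^ r = x * x ^ r.-1 by rewrite -expnS prednK.
  rewrite (powS #|M|) mulnCA [leqLHS]mulnC leq_pmul2l // => le1.
  have leM : #|M| <= a * D by apply: degY.
  have a_gt0 : 0 < a by move: (leq_trans M_gt0 leM); rewrite muln_gt0 => /andP[].
  apply: leq_trans le1 _; apply: leq_trans (leq_mul (leqnn D) (leq_expl _ leM)) _.
  by rewrite expnMn mulnCA -powS leq_mul2r (powS a) leq_pmull ?orbT.
have sum_le : P * rich_stars D r Y X <= #|Y| * (r * 2 ^ r * (a ^ r * D ^ r)).
  have le1 : rich_stars D r Y X <= \sum_(y in Y) \sum_(p : 'I_r * {set 'I_r})
      #|[set f : {ffun 'I_r -> G} | (f \in ffun_on (mem (nbrs y :&: X))) && rel f p]|.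
    rewrite /rich_stars.
    under eq_bigr => f _ do rewrite -sum1_card.
    rewrite (exchange_big_dep (mem Y)) /=; last by move=> f y _; rewrite inE => /andP[].
    apply: leq_sum => y yY.
    under [leqRHS]eq_bigr => p _ do rewrite -sum1_card.
    rewrite (exchange_big_dep xpredT) //= [leqLHS]big_mkcond; apply: leq_sum => f _.
    case: ifP => // /andP[/andP[fX fD] fy]; have := none f; rewrite /= fX fD /=.
    move/negbT; rewrite negb_forall => /existsP[p]; rewrite negbK => rp.
    rewrite (bigD1 p) ?leq_addr //= inE rp andbT; apply/ffun_onP => j.
    move: fX fy; rewrite !inE => /andP[/forallP fX _] /andP[_ /forallP fy].
    by rewrite fX fy.
  apply: leq_trans (leq_mul (leqnn P) le1) _; rewrite big_distrr -sum_nat_const /=.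
  apply: leq_sum => y yY; rewrite big_distrr /=.
  apply: leq_trans (_ : \sum_(p : 'I_r * {set 'I_r}) a ^ r * D ^ r <= _).
    by apply: leq_sum => p _; apply: bound.
  by rewrite sum_nat_const card_prod card_ord -cardsT -powersetT card_powerset cardsT card_ord.
have Y_gt0 : 0 < #|Y| by rewrite card_gt0.
have DY : 0 < D ^ r * #|Y| by rewrite muln_gt0 expn_gt0 D_gt0.
have := leq_mul (leqnn P) rich; have := leq_mul (leqnn g) sum_le.
rewrite mulnCA => h1 h2; have := leq_trans h2 h1.
have -> : g * (#|Y| * (r * 2 ^ r * (a ^ r * D ^ r))) = g * (r * 2 ^ r * a ^ r) * (D ^ r * #|Y|) by lia.
by rewrite leq_pmul2r // leqNgt P_large.
Qed.

(** Each entry outside I removes at most a P-th of the common neighbourhood of the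
entries in I. *)
Lemma exact_trace r (f : {ffun 'I_r -> G}) (I : {set 'I_r}) :
  2 * r <= P -> D <= #|common Y f| -> unrelated f ->
  D <= 2 * #|[set y in Y | [forall j, adj y (f j) == (j \in I)]]|.
Proof.
move=> P_large leD unr; set E := [set y in Y | _]; set Z := commonI f I.
have leZ : D <= #|Z|.
  apply: leq_trans leD _; apply: subset_leq_card; apply/subsetP => y; rewrite !inE => /andP[-> /forallP h].
  by apply/forallP => j; apply/implyP => _; exact: h.
have cZ : #|Z| <= #|E| + \sum_(j in ~: I) #|nbrs (f j) :&: Z|.
  have sub : Z \subset E :|: \bigcup_(j in ~: I) (nbrs (f j) :&: Z).
    apply/subsetP => y yZ; rewrite inE; case: (boolP (y \in E)) => //= yE; apply/bigcupP.
    have := yZ; rewrite inE => /andP[yY /forall_inP yI].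
    move: yE; rewrite inE yY /= negb_forall => /existsP[j]; case: (boolP (j \in I)) => jI.
      by rewrite yI.
    rewrite eqbF_neg negbK => ayj; exists j; first by rewrite inE.
    by rewrite inE in_nbrs adj_sym ayj.
  apply: leq_trans (subset_leq_card sub) _; apply: leq_trans (leq_card_setU _ _) _.
  by rewrite leq_add2l card_bigcup_le.
have le1 : P * \sum_(j in ~: I) #|nbrs (f j) :&: Z| <= r * #|Z|.
  rewrite big_distrr /=; apply: leq_trans (_ : \sum_(j in ~: I) #|Z| <= _).
    by apply: leq_sum => j; rewrite inE => /unr/ltnW.
  by rewrite sum_nat_const leq_mul2r -[leqRHS]card_ord max_card orbT.
have [r0|r_gt0] := posnP r.
  by move: cZ; rewrite big1 ?addn0; [lia | move=> j _; have : j < 0 by apply: leq_trans (ltn_ord j) _; rewrite r0].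
have : 2 * \sum_(j in ~: I) #|nbrs (f j) :&: Z| <= #|Z|.
  rewrite -(leq_pmul2l r_gt0); apply: leq_trans le1; rewrite mulnA leq_mul2r mulnC P_large orbT //.
lia.
Qed.

(** Greedy choice.  Local sparsity provides a vertex of the first set that is
adjacent to less than half of each later set, and the later sets are then cut
down to its non-neighbours. *)
Lemma independent_transversal (T : finType) (N : nat) (Z : T -> {set G}) :
  locally_sparse G D P -> 0 < D -> N * 2 ^ N < P -> #|T| < N ->
  (forall u, D <= 2 * #|Z u|) ->
  exists2 c : T -> G, forall u, c u \in Z u & forall u v, u != v -> ~~ adj (c u) (c v).
Proof.
move=> sp D_gt0 P_large leN leZ.
suff [c cZ cN] : exists2 c : T -> G, {in enum T, forall u, c u \in Z u} &
    {in enum T &, forall u v, u != v -> ~~ adj (c u) (c v)}.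
  by exists c => [u|u v]; [apply: cZ | apply: cN]; rewrite mem_enum.
have [x0 _|no_vertex] := pickP (@predT G); last first.
  have noT (u : T) : False.
    have /card_gt0P[x _] : 0 < #|Z u| by have := leZ u; lia.
    by have := no_vertex x.
  by exists (fun u => False_rect _ (noT u)) => u; case: (noT u).
suff gen (l : seq T) j (Z' : T -> {set G}) : uniq l -> size l + j <= N ->
    {in l, forall u, D <= 2 ^ j * #|Z' u|} ->
    exists2 c : T -> G, {in l, forall u, c u \in Z' u} &
      {in l &, forall u v, u != v -> ~~ adj (c u) (c v)}.
  by apply: (gen _ 1); rewrite ?enum_uniq // -cardE addn1.
elim: l j Z' => {Z leZ leN} [|u l IHl] j Z.
  by exists (fun=> x0).
rewrite cons_uniq => /andP[ul l_uniq] leN leZ.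
pose Rl v := [set b | #|Z v| <= P * #|nbrs b :&: Z v|].
have P_gt0 : 2 ^ j <= P.
  apply: leq_trans (ltnW P_large); apply: leq_trans (_ : 2 ^ N <= _).
    by rewrite leq_exp2l //; move: leN => /=; lia.
  by rewrite leq_pmull //; move: leN => /=; lia.
have leR v : v \in l -> P * #|Rl v| <= D.
  move=> vl; apply: sp; apply: leq_trans (leZ v _) _; first by rewrite inE vl orbT.
  by rewrite leq_mul2r P_gt0 orbT.
have [b bZ bR] : exists2 b, b \in Z u & forall v, v \in l -> b \notin Rl v.
  pose R := \bigcup_(v in l) Rl v.
  have leRR : P * #|R| <= N * D.
    apply: leq_trans (leq_mul (leqnn P) (card_bigcup_le _ _)) _.
    rewrite big_distrr /=; apply: leq_trans (_ : \sum_(v in l) D <= _).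
      by apply: leq_sum => v; apply: leR.
    rewrite sum_nat_const leq_mul2r; apply/orP; right.
    by apply: leq_trans (card_size l) _; rewrite /= in leN; lia.
  have ltR : #|R| < #|Z u|.
    have le2 : D <= 2 ^ j * #|Z u| by apply: leZ; rewrite inE eqxx.
    rewrite ltnNge; apply/negP => le3.
    have : P * D <= N * 2 ^ j * D.
      apply: leq_trans (_ : P * (2 ^ j * #|R|) <= _).
        by rewrite leq_mul2l (leq_trans le2) ?orbT // leq_mul2l le3 orbT.
      by rewrite mulnCA [N * _]mulnC -[leqRHS]mulnA leq_mul2l leRR orbT.
    rewrite leq_pmul2r // leqNgt => /negP; apply; apply: leq_ltn_trans P_large.
    by rewrite leq_mul2l leq_exp2l //; apply/orP; right; move: leN => /=; lia.
  have /subsetPn[b bZ bR] : ~~ (Z u \subset R).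
    by apply/negP => /subset_leq_card; rewrite leqNgt ltR.
  by exists b => // v vl; apply: contra bR => bv; apply/bigcupP; exists v.
pose Z' v := Z v :\: nbrs b.
have [||c cZ cN] := IHl j.+1 Z' l_uniq.
- by rewrite /= in leN; lia.
- move=> v vl; apply: leq_trans (leZ v _) _; first by rewrite inE vl orbT.
  rewrite expnSr -mulnA leq_mul2l; apply/orP; right.
  have lt_b : P * #|nbrs b :&: Z v| < #|Z v| by have := bR v vl; rewrite inE -ltnNge.
  have eqZ : #|nbrs b :&: Z v| + #|Z' v| = #|Z v| by rewrite setIC cardsID.
  have P2 : 2 <= P.
    apply: leq_trans (ltnW P_large); apply: leq_trans (_ : N <= _).
      by move: leN vl => /=; case: (l) => //= *; lia.
    by rewrite leq_pmulr // expn_gt0.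
  have := leq_mul P2 (leqnn #|nbrs b :&: Z v|).
  by move: lt_b eqZ; move: #|_ :&: _| #|Z' v| #|Z v| => x y z; lia.
have notb z : z \in l -> ~~ adj b (c z) by move/cZ; rewrite !inE => /andP[].
exists (fun v => if v == u then b else c v) => [v|v w].
  rewrite inE; case: eqP => [->//|_ /= vl].
  by have /setDP[] := cZ v vl.
rewrite !inE; have [->|_] := eqVneq v u; have [->|_] := eqVneq w u => //= vl wl vw.
- exact: notb.
- by rewrite adj_sym; apply: notb.
exact: cN.
Qed.
End Shatter.

(** * A dense bipartite graph without large bicliques *)
Section Parity.
Variable t : nat.
Implicit Types u v w : {set 'I_t}.

Definition odd_meet u v := odd #|u :&: v|.

Definition toggle i u : {set 'I_t} := [set x | (x \in u) (+) (x == i)].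

Lemma toggleK i : involutive (toggle i).
Proof. by move=> u; apply/setP => x; rewrite !inE -addbA addbb addbF. Qed.

Lemma odd_meetC u v : odd_meet u v = odd_meet v u.
Proof. by rewrite /odd_meet setIC. Qed.

Lemma odd_meet_toggle i u v : odd_meet (toggle i u) v = odd_meet u v (+) (i \in v).
Proof.
rewrite /odd_meet (cardsD1 i) [#|u :&: v|](cardsD1 i) !oddD.
have -> : (toggle i u :&: v) :\ i = (u :&: v) :\ i.
  by apply/setP => x; rewrite !inE; case: eqP => //= _; rewrite addbF.
rewrite !inE eqxx addbT; case: (i \in u); case: (i \in v) => //=;
  by rewrite ?addbF ?addbT ?negbK.
Qed.

Lemma odd_meet_inj u w : odd_meet u =1 odd_meet w -> u = w.
Proof.
move=> e; apply/setP => i; have := e [set i]; rewrite !(odd_meetC _ [set i]) /odd_meet.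
have h z : odd #|[set i] :&: z| = (i \in z).
  case: (boolP (i \in z)) => iz; first by rewrite (setIidPl _) ?sub1set // cards1.
  by rewrite (_ : _ :&: _ = set0) ?cards0 //; apply/setP => x; rewrite !inE; case: eqP => // ->; rewrite (negPf iz).
by rewrite !h.
Qed.

Lemma sum_odd_meet v : v != set0 -> 2 * \sum_u odd_meet u v = #|{: {set 'I_t}}|.
Proof.
case/set0Pn => i iv; rewrite mul2n -addnn [X in X + _](reindex_inj (inv_inj (toggleK i))) /=.
rewrite -big_split -sum1_card; apply: eq_bigr => u _ /=.
by rewrite odd_meet_toggle iv addbT; case: odd_meet.
Qed.

(** The signs of parities of intersections are the characters of the group of
subsets, which are pairwise orthogonal.  So the sum over u of the square of the
sum over V of the signs is |V| times the order of the group, while each u in U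
contributes |V|^2 to it. *)
Lemma odd_meet_rectangle (U V : {set {set 'I_t}}) :
  {in U & V, forall u v, odd_meet u v} -> #|U| * #|V| <= #|{: {set 'I_t}}|.
Proof.
move=> UV; have [V0|V_gt0] := posnP #|V|; first by rewrite V0 muln0.
rewrite -(leq_pmul2r V_gt0).
pose s u v : int := ((-1) ^+ odd_meet u v)%R.
have orth v w : (\sum_u s u v * s u w = if v == w then #|{: {set 'I_t}}|%:R else 0)%R.
  case: eqP => [->|/eqP vw].
    rewrite -sumr_const; apply: eq_bigr => u _; by rewrite /s; case: odd_meet.
  have [i iE] : exists i, (i \in v) (+) (i \in w).
    case: (pickP (fun i => (i \in v) (+) (i \in w))) => [i|e]; first by exists i.
    by case/eqP: vw; apply/setP => i; have := e i; case: (i \in v); case: (i \in w).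
  set S := (\sum_u _)%R; have : S = (- S)%R.
    rewrite {1}/S (reindex_inj (inv_inj (toggleK i))) /= -sumrN; apply: eq_bigr => u _.
    rewrite /s !odd_meet_toggle; move: iE; case: (i \in v); case: (i \in w) => //= _;
    by case: (odd_meet u v); case: (odd_meet u w).
  lia.
have eqN : (\sum_u (\sum_(v in V) s u v) ^+ 2 = (#|{: {set 'I_t}}| * #|V|)%:R)%R.
  transitivity (\sum_(v in V) \sum_(w in V) \sum_u s u v * s u w)%R.
    rewrite [RHS](eq_bigr (fun v => \sum_u \sum_(w in V) s u v * s u w)%R); last first.
      by move=> v _; rewrite exchange_big.
    rewrite [RHS]exchange_big; apply: eq_bigr => u _.
    by rewrite expr2 big_distrl; apply: eq_bigr => v _; rewrite big_distrr.
  rewrite mulnC natrM -sumr_const mulr_suml; apply: eq_bigr => v vV; rewrite mul1r.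
  rewrite (bigD1 v) //= orth eqxx big1 ?addr0 // => w /andP[_ wv].
  by rewrite orth eq_sym (negPf wv).
rewrite -(ler_nat int) -eqN (bigID (mem U)) /=.
apply: (@le_trans _ _ (\sum_(u in U) (\sum_(v in V) s u v) ^+ 2)%R); last first.
  by rewrite lerDl; apply: sumr_ge0 => u _; apply: sqr_ge0.
rewrite (eq_bigr (fun=> (#|V| ^ 2)%:R)%R) => [|u uU]; last first.
  rewrite (eq_bigr (fun=> -1)%R) => [|v vV]; last by rewrite /s UV.
  by rewrite sumr_const mulNrn sqrrN natrX.
by rewrite sumr_const -mulrnA ler_nat -mulnA mulnn mulnC.
Qed.
End Parity.

(** The vertices c u with trace prescribed by odd intersections and the entries
b v of the tuple induce a bipartite graph on 2 r vertices with about r^2/2 edges,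
in which a biclique has at most sqrt r vertices on each side. *)
Lemma no_shattered_star (G : sgraph) D P e t (Y X : {set G}) :
  let r := #|{: {set 'I_t}}| in
  dense_biclique G 8 e -> 0 < t -> e ^ 2 < 2 ^ t -> locally_sparse G D P -> 0 < D ->
  r.+1 * 2 ^ r.+1 < P -> [disjoint Y & X] ->
  forall f : {ffun 'I_r -> G}, f \in spread_maps (@adj G) r X ->
  D <= #|common Y f| -> unrelated P Y f -> False.
Proof.
move=> r dense t_gt0 t_large sp D_gt0 P_large disYX f fX leD unr.
have rE : r = 2 ^ t by rewrite /r -cardsT -powersetT card_powerset cardsT card_ord.
have P2r : 2 * r <= P.
  apply: leq_trans (ltnW P_large); rewrite mulnC leq_mul // expnS leq_pmulr ?expn_gt0 //.
pose E (u : {set 'I_t}) := [set y in Y | [forall j, adj y (f j) == (j \in [set j' : 'I_r | odd_meet u (enum_val j')])]].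
have leE u : D <= 2 * #|E u| by apply: exact_trace P2r leD unr.
have [c cE cN] := independent_transversal sp D_gt0 P_large (ltnSn r) leE.
pose b (v : {set 'I_t}) := f (enum_rank v).
have adj_cb u v : adj (c u) (b v) = odd_meet u v.
  have := cE u; rewrite inE => /andP[_ /forallP/(_ (enum_rank v))/eqP ->].
  by rewrite inE enum_rankK.
have cY u : c u \in Y by have := cE u; rewrite inE => /andP[].
have bX v : b v \in X by move: fX; rewrite inE => /andP[/forallP h _]; exact: h.
have c_inj : injective c.
  by move=> u u' e_c; apply: odd_meet_inj => v; rewrite -!adj_cb e_c.
have P_gt0 : 0 < P by apply: leq_ltn_trans P_large.
have b_inj : injective b.
  move=> v v' e_b; apply/eqP; apply: contraT => vv'.
  have /unr : enum_rank v \notin [set enum_rank v'] by rewrite inE (inj_eq enum_rank_inj).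
  have -> : nbrs (f (enum_rank v)) :&: commonI Y f [set enum_rank v'] = commonI Y f [set enum_rank v'].
    apply/setIidPr/subsetP => y; rewrite inE => /andP[_ /forall_inP/(_ (enum_rank v'))].
    rewrite set11 in_nbrs adj_sym => /(_ isT); rewrite -/(b v') -e_b; exact.
  by rewrite ltnNge leq_pmull.
have bN v v' : ~~ adj (b v) (b v').
  have [->|vv'] := eqVneq v v'; first by rewrite adj_irrefl.
  move: fX; rewrite inE => /andP[_ /spreadP]; apply; by rewrite (inj_eq enum_rank_inj).
have cN' u u' : ~~ adj (c u) (c u').
  by have [->|uu'] := eqVneq u u'; [rewrite adj_irrefl | exact: cN].
pose A := [set c u | u in [set: {set 'I_t}]]; pose B := [set b v | v in [set: {set 'I_t}]].
have cA : #|A| = r by rewrite card_imset // cardsT.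
have cB : #|B| = r by rewrite card_imset // cardsT.
have dAB : A :&: B = set0.
  apply/setP => x; rewrite !inE; apply/negP => /andP[/imsetP[u _ ->] /imsetP[v _ e_cb]].
  by have := cY u; rewrite e_cb (disjointFl disYX (bX v)).
have cW : #|A :|: B| = 2 * r by rewrite cardsU dAB cards0 cA cB; lia.
have r_gt1 : 1 < r by rewrite rE -(expn0 2) ltn_exp2l.
have arcsAB : r ^ 2 <= 4 * arcs A B.
  have -> : arcs A B = \sum_(v : {set 'I_t}) \sum_u odd_meet u v.
    rewrite arcsC arcsE /B big_imset /=; last by move=> ? ? _ _ /b_inj.
    apply: eq_big => [v|v _]; first by rewrite inE.
    rewrite /A big_imset /=; last by move=> ? ? _ _ /c_inj.
    by apply: eq_big => [u|u _]; rewrite ?inE // adj_sym adj_cb.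
  have le1 : r.-1 * r <= 2 * \sum_(v : {set 'I_t}) \sum_u odd_meet u v.
    rewrite big_distrr /= [leqRHS](bigD1 set0) //=; apply: leq_trans (leq_addl _ _).
    rewrite (eq_bigr (fun=> r)) => [|v v0]; last by rewrite sum_odd_meet.
    by rewrite sum_nat_const leq_mul2r -(cardC1 (set0 : {set 'I_t})) leqnn orbT.
  have le2 : r ^ 2 <= 2 * (r.-1 * r) by rewrite -mulnn mulnA leq_mul2r; apply/orP; right; lia.
  by apply: leq_trans le2 _; rewrite -[4]/(2 * 2) -mulnA leq_mul2l.
have arcsW : 2 * arcs A B <= arcs (A :|: B) (A :|: B).
  rewrite mul2n -addnn (arcsDl _ (subsetUl A B)); apply: leq_add; first by rewrite arcsS // subsetUr.
  rewrite arcsC arcsS ?subsetUl //; apply/subsetP => x xB; rewrite !inE xB orbT andbT.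
  by apply/negP => xA; have := in_set0 x; rewrite -dAB inE xA xB.
have [||m le_m [f1 [f2 [f1_inj f2_inj f1W f2W f12]]]] := dense (A :|: B).
- by rewrite cW; lia.
- rewrite cW; lia.
have m2 : m * m <= r.
  have key (g h : 'I_m -> G) (i0 : 'I_m) : injective g -> injective h ->
      (forall i, g i \in A :|: B) -> (forall j, h j \in A :|: B) ->
      (forall i j, adj (g i) (h j)) -> g i0 \in A -> m * m <= r.
    move=> g_inj h_inj gW hW gh gA.
    have hB j : exists v, h j = b v.
      have := gh i0 j; case/imsetP: gA => u _ ->; have /setUP[] := hW j => /imsetP[v _ ->].
        by rewrite (negPf (cN' u v)).
      by exists v.
    have gAc i : exists u, g i = c u.
      have [v hv] := hB i0; have := gh i i0; have /setUP[] := gW i => /imsetP[u _ ->].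
        by exists u.
      by rewrite hv (negPf (bN u v)).
    have [gu guE] := fin_all_exists gAc; have [hv hvE] := fin_all_exists hB.
    have gu_inj : injective gu by move=> i j e_g; apply: g_inj; rewrite !guE e_g.
    have hv_inj : injective hv by move=> i j e_h; apply: h_inj; rewrite !hvE e_h.
    have := @odd_meet_rectangle t [set gu i | i in 'I_m] [set hv j | j in 'I_m].
    rewrite !card_imset // !card_ord; apply => u v /imsetP[i _ ->] /imsetP[j _ ->].
    by rewrite -adj_cb -guE -hvE.
  case: (posnP m) => [->//|m_gt0].
  pose i0 := Ordinal m_gt0.
  have /setUP[f1A|f1B] := f1W i0; first exact: (key f1 f2 i0).
  apply: (key f2 f1 i0) => // [i j|]; first by rewrite adj_sym.
  have := f12 i0 i0; case/imsetP: f1B => v _ ->; have /setUP[//|/imsetP[v' _ ->]] := f2W i0.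
  by rewrite (negPf (bN v v')).
rewrite cW in le_m.
have := leq_mul le_m le_m; have := leq_mul (leqnn (e ^ 2)) m2.
move: t_large; rewrite -rE -(ltn_pmul2r (ltnW r_gt1)) -!mulnn => h1 h2 h3.
have : 2 * r * (2 * r) < r * r by apply: leq_ltn_trans h3 (leq_ltn_trans _ h1); rewrite mulnACA.
by rewrite ltnNge => /negP; apply; apply: leq_mul; lia.
Qed.

(** * From the family to its members *)
Section InducedSubgraph.
Variables (G : sgraph) (W : {set G}).

Lemma sum_degree_induced : \sum_(x : induced W) degree x = arcs W W.
Proof.
rewrite /arcs [RHS]big_sub.
apply: eq_bigr => x _; rewrite /degree -(card_imset _ val_inj); apply: eq_card => y.
apply/imsetP/idP => [[z + ->]|]; first by rewrite !inE (valP z) andbT.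
by rewrite !inE => /andP[axy yW]; exists (Sub y yW); rewrite ?inE /induced_adj ?SubK.
Qed.

Lemma card_induced : #|induced W| = #|W|.
Proof. by rewrite card_sig; apply: eq_card. Qed.

Lemma biclique_in_induced m : has_biclique (induced W) m -> biclique_in W m.
Proof.
case=> h h_inj h_adj; exists (fun i => val (h (inl i))), (fun j => val (h (inr j))).
split=> [i i' /val_inj/h_inj[]|j j' /val_inj/h_inj[]|i|j|i j] //; try exact: valP.
exact: (h_adj (inl i) (inr j)).
Qed.

Lemma c4free_induced : c4free W -> subgraph_free C4 (induced W).
Proof.
move=> free [h h_inj h_adj].
pose v n (lt_n : n < 4) : induced W := h (Ordinal lt_n).
have nv n n' (ln : n < 4) (ln' : n' < 4) : n != n' -> val (v n ln) != val (v n' ln').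
  by rewrite (inj_eq val_inj) /v (inj_eq h_inj) -val_eqE.
have av n n' (ln : n < 4) (ln' : n' < 4) : (n.+1 %% 4 == n') -> adj (val (v n ln)) (val (v n' ln')).
  by move=> e; apply: (h_adj (Ordinal ln) (Ordinal ln')); rewrite /adj /= /C4_adj /= e.
by apply: (free (val (v 0 isT)) (val (v 1 isT)) (val (v 2 isT)) (val (v 3 isT)));
  rewrite ?(valP (v _ _)) ?av ?nv.
Qed.
End InducedSubgraph.

Lemma sum_degree_le_edges (H : sgraph) : \sum_(x : H) degree x <= 2 * #|edges H|.
Proof.
pose A := [set p : H * H | adj p.1 p.2].
have -> : \sum_(x : H) degree x = #|A|.
  have -> : #|A| = \sum_(x : H) \sum_(y : H) (if adj x y then 1 else 0).
    by rewrite -sum1_card big_mkcond pair_bigA; apply: eq_bigr => -[x y] _; rewrite inE.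
  by apply: eq_bigr => x _; rewrite /degree -sum1_card big_mkcond; apply: eq_bigr => y _; rewrite inE.
rewrite -sum1_card (partition_big_imset (fun p => [set p.1; p.2])) /= mulnC -sum_nat_const.
apply: leq_sum => E /imsetP[[x y] xyA ->] /=; rewrite sum1dep_card.
have nxy : x != y by move: xyA; rewrite inE /=; apply: contraTneq => ->; rewrite adj_irrefl.
apply: leq_trans (_ : #|[set (x, y); (y, x)]| <= _); last by rewrite cards2; case: (_ == _).
apply: subset_leq_card; apply/subsetP => -[x' y']; rewrite inE => /andP[+ /eqP/setP e].
rewrite inE /= => axy.
have nxy' : x' != y' by apply: contraTneq axy => ->; rewrite adj_irrefl.
have := e x'; have := e y'; rewrite !inE /= !eqxx orbT /= => /esym/orP[]/eqP ey /esym/orP[]/eqP ex; subst;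
  rewrite ?eqxx ?orbT // in nxy' *.
Qed.

Lemma biclique_lt (G : sgraph) (W : {set G}) m s :
  subgraph_free (complete_bipartite s s) G -> biclique_in W m -> m < s.
Proof.
move=> free [f [g [f_inj g_inj _ _ fg]]]; rewrite ltnNge; apply/negP => le_sm; apply: free.
exists (fun v : 'I_s + 'I_s => match v with inl i => f (widen_ord le_sm i) | inr j => g (widen_ord le_sm j) end).
  have w_inj : injective (widen_ord le_sm) by move=> i j /(congr1 val) /= /val_inj.
  have fg_neq i j : f i <> g j by move=> e; have := fg i j; rewrite e adj_irrefl.
  case=> i [] j //= => [/f_inj/w_inj->|/fg_neq|/esym/fg_neq|/g_inj/w_inj->] //.
by case=> i [] j //= _; rewrite // adj_sym.
Qed.

Section Real.
Variables (R : realType) (F : sgraph -> Prop).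
Hypothesis F_hered : hereditary F.
Local Open Scope ring_scope.

Lemma weakly_degree_bounded_nat : weakly_degree_bounded R F ->
  exists k, forall G : sgraph, F G -> c4free_bounded G k.
Proof.
case=> r rP; exists (Num.bound r) => G FG W free.
have := rP _ (F_hered W FG) (c4free_induced free).
rewrite /average_degree sum_degree_induced card_induced => le.
have [->|W_neq0] := eqVneq W set0; first by rewrite /arcs big_set0.
have W_gt0 : 0 < #|W|%:R :> R by rewrite ltr0n card_gt0.
rewrite -(ler_nat R) natrM -ler_pdivrMr //; apply: le_trans (le) (ltW (archi_boundP _)).
by apply: le_trans le; rewrite divr_ge0.
Qed.

Lemma density_EH_nat : density_EH R F -> forall q, exists e, forall G : sgraph, F G -> dense_biclique G q e.
Proof.
move=> EH q; have c_gt0 : 0 < (q.+1%:R : R)^-1 by rewrite invr_gt0 ltr0n.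
have [delta d_gt0 dP] := EH _ c_gt0.
have d1_ge0 : 0 <= delta^-1 by rewrite invr_ge0 ltW.
exists (Num.bound delta^-1) => G FG W W2 dense.
have [|m dm bic] := dP _ (F_hered W FG).
  rewrite /edge_density card_induced.
  have C_gt0 : (0 < 'C(#|W|, 2))%N by rewrite bin_gt0.
  rewrite ler_pdivlMr ?ltr0n // mulrC ler_pdivrMr ?ltr0n // -natrM ler_nat.
  have := sum_degree_le_edges (induced W); rewrite sum_degree_induced.
  have := bin2 #|W|; have := mul_bin_diag #|W| 1; move: dense; rewrite bin1; nia.
exists m; last exact: biclique_in_induced.
rewrite card_induced in dm.
rewrite -(ler_nat R) natrM; apply: le_trans (_ : delta^-1 * m%:R <= _).
  by rewrite mulrC ler_pdivlMr // mulrC.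
by rewrite ler_wpM2r ?ler0n // ltW // archi_boundP.
Qed.
End Real.

Local Open Scope ring_scope.

(** D - 1 is the largest integer that is a lower bound for the average degree of
some vertex set. *)
Lemma densest_scale (G : sgraph) n : (0 < n)%N -> (exists2 W : {set G}, W != set0 & (n * #|W| <= arcs W W)%N) ->
  exists D, [/\ (n < D)%N, forall U : {set G}, (arcs U U <= D * #|U|)%N &
    exists2 W : {set G}, W != set0 & (D * #|W| <= 2 * arcs W W)%N].
Proof.
move=> n_gt0 [W W_neq0 leW].
pose p m := [exists W : {set G}, (W != set0) && (m * #|W| <= arcs W W)%N].
have pn : exists m, p m by exists n; apply/existsP; exists W; rewrite W_neq0.
have pb m : p m -> (m <= #|G|)%N.
  case/existsP=> U /andP[U0 leU]; rewrite -(leq_pmul2r (_ : 0 < #|U|)%N) ?card_gt0 //.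
  by apply: leq_trans leU _; apply: arcs_le => x _; apply: max_card.
case: (ex_maxnP pn pb) => m /existsP[W' /andP[W'0 leW']] mmax.
have le_nm : (n <= m)%N by apply: mmax; apply/existsP; exists W; rewrite W_neq0.
exists m.+1; split=> [//|U|].
  have [->|U0] := eqVneq U set0; first by rewrite /arcs big_set0.
  rewrite leqNgt; apply/negP => ltU.
  by have := mmax m.+1; rewrite ltnn; apply/implyP/existsP; exists U; rewrite U0 ltnW.
exists W' => //; apply: leq_trans (leq_mul (leqnn 2) leW').
rewrite mulnA leq_mul2r; apply/orP; right; lia.
Qed.

(** The constants are chosen in the order k, e, then q, then e', then C0: the
sparsity parameter P, hence the density 1/q at which bicliques are required, may
depend on everything except C0, which only has to make D large. *)
Lemma average_degree_bound k e : exists q, forall e', exists C0, forall (G : sgraph) s,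
  (0 < s)%N -> c4free_bounded G k -> dense_biclique G 8 e -> dense_biclique G q e' ->
  subgraph_free (complete_bipartite s s) G ->
  forall W : {set G}, W != set0 -> (arcs W W < C0 * s * #|W|)%N.
Proof.
pose t := (e ^ 2).+1; pose r := #|{: {set 'I_t}}|.
have r_gt0 : (0 < r)%N by rewrite /r -cardsT -powersetT card_powerset expn_gt0.
have [K [g [P1 [D1 rich]]]] := rich_stars_ge 64 k r 32.
have [P2 [D2 bdeg]] := bounded_degree_few_arcs (512 * K.+1) k 16.
pose P := (P1 + P2 + g * (r * 2 ^ r * 64 ^ r) + r.+1 * 2 ^ r.+1).+1.
exists (4 * P)%N => e'.
pose C0 := (P * (e' + 2) + D1 + D2).+1.
exists C0 => G s s_gt0 c4k dense8 denseq free W W0; rewrite ltnNge; apply/negP => leW.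
have [|D [ltD arcsD [W' W'0 leW']]] := @densest_scale G (C0 * s) _ (ex_intro2 _ _ W W0 leW).
  by rewrite muln_gt0 s_gt0.
have D_ge : (P * (e' * s + 2) + D1 + D2 < D)%N.
  apply: leq_ltn_trans ltD; have : (C0 <= C0 * s)%N by apply: leq_pmulr.
  have : (P * (e' * s + 2) <= P * (e' + 2) * s)%N.
    by rewrite -mulnA leq_mul2l; apply/orP; right; rewrite mulnDl leq_add2l leq_pmulr.
  have : (D1 + D2 <= (D1 + D2) * s)%N by apply: leq_pmulr.
  rewrite /C0 mulSn !mulnDl; lia.
have sp : locally_sparse G D P.
  apply: (locally_sparse_of_biclique_free (s := s) _ denseq) => //.
    by move=> U m; apply: biclique_lt.
  by lia.
have D_gt0 : (0 < D)%N by lia.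
have [|Y [X [Y0 disYX leK degY richY]]] := unbalanced_pair (K := K) arcsD _ D_gt0 W'0 leW'.
  move=> Q degQ; apply: bdeg c4k _ degQ; first lia.
  by apply: locally_sparse_le sp; rewrite /P; lia.
have starY : (D ^ r * #|Y| <= g * rich_stars D r Y X)%N.
  apply: rich arcsD c4k _ disYX degY richY leK; first lia.
  by apply: locally_sparse_le sp; rewrite /P; lia.
have [|f fX [leD unr]] := unrelated_star sp D_gt0 Y0 degY r_gt0 starY.
  by rewrite /P; lia.
apply: (no_shattered_star dense8 _ _ sp D_gt0 _ disYX fX leD unr) => //.
  by rewrite /t; apply: ltn_trans (ltn_expl _ (ltnSn 1)) _; rewrite ltn_exp2l.
by rewrite /P -/r; lia.
Qed.

Theorem corollary1p10 (R : realType) (F : sgraph -> Prop) :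
  hereditary F -> weakly_degree_bounded R F -> density_EH R F ->
  exists2 C : R, 0 < C &
  forall s : nat, (0 < s)%N ->
  forall G : sgraph, F G -> subgraph_free (complete_bipartite s s) G ->
  average_degree R G <= C * s%:R.
Proof.
move=> hered wdb EH.
have [k c4k] := weakly_degree_bounded_nat hered wdb.
have [e dense8] := density_EH_nat hered EH 8.
have [q bound_q] := average_degree_bound k e.
have [e' denseq] := density_EH_nat hered EH q.
have [C0 bound] := bound_q e'.
exists C0.+1%:R => [|s s_gt0 G FG free]; first by rewrite ltr0n.
rewrite /average_degree.
have [G0|G_gt0] := posnP #|G|; first by rewrite G0 invr0 mulr0 mulr_ge0.
rewrite ler_pdivrMr ?ltr0n // -!natrM ler_nat.
have -> : (\sum_(x : G) degree x = arcs [set: G] [set: G])%N.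
  by apply: eq_big => x; rewrite ?inE // /degree setIT.
have := bound G s s_gt0 (c4k G FG) (dense8 G FG) (denseq G FG) free [set: G].
rewrite -card_gt0 cardsT => /(_ G_gt0)/ltnW/leq_trans; apply.
by rewrite -!mulnA leq_mul2r leqnSn orbT.
Qed.
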